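(* There exist a compact set $K\subset\mathbb{C}$ and a holomorphic motion $g:\mathbb{D}\times\widehat{\mathbb{C}}\to\widehat{\mathbb{C}}$ with $g(\lambda,\infty)=\infty$ for all $\lambda\in\mathbb{D}$ such that, writing $K_\lambda:=g(\lambda,K)$ for $\lambda\in\mathbb{D}$, both functions $$\lambda\mapsto\gamma(K_\lambda),\qquad \lambda\mapsto\alpha(K_\lambda)\qquad(\lambda\in\mathbb{D})$$ are discontinuous at $\lambda=0$.
   Context: $\mathbb{D}=\{z\in\mathbb{C}:|z|<1\}$ and $\widehat{\mathbb{C}}=\mathbb{C}\cup\{\infty\}$ is the Riemann sphere. A holomorphic motion of $\widehat{\mathbb{C}}$ is a map $h:\mathbb{D}\times\widehat{\mathbb{C}}\to\widehat{\mathbb{C}}$ such that (i) for each fixed $z\in\widehat{\mathbb{C}}$, the map $\lambda\mapsto h(\lambda,z)$ is holomorphic on $\mathbb{D}$; (ii) for each fixed $\lambda\in\mathbb{D}$, the map $z\mapsto h(\lambda,z)$ is injective on $\widehat{\mathbb{C}}$; (iii) $h(0,z)=z$ for all $z\in\widehat{\mathbb{C}}$. For a set $S$, $h(\lambda,S)=\{h(\lambda,z):z\in S\}$. By the $\lambda$-lemma every holomorphic motion is jointly continuous, so if $h$ fixes $\infty$ and $S\subset\mathbb{C}$ is compact, then $h(\lambda,S)$ is a compact subset of $\mathbb{C}$ for every $\lambda$. For a compact set $S\subset\mathbb{C}$, put $D=\widehat{\mathbb{C}}\setminus S$ (an open set containing $\infty$, not necessarily connected). $H^\infty(D)$ is the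 space of bounded analytic functions on $D$, and $A(D)$ is the subspace consisting of the continuous functions $\widehat{\mathbb{C}}\to\mathbb{C}$ that are analytic on $D$. For $f$ analytic near $\infty$, $f'(\infty):=\lim_{z\to\infty}z(f(z)-f(\infty))$. The analytic capacity of $S$ is $$\gamma(S):=\sup\{|f'(\infty)|: f\in H^\infty(D),\ |f|\le 1\text{ on }D\},$$ and the continuous analytic capacity of $S$ is $$\alpha(S):=\sup\{|f'(\infty)|: f\in A(D),\ |f|\le 1\text{ on }\mathbb{C}\}.$$ *)

(* Defs.v *)
From HB Require Import structures.
From mathcomp Require Import all_boot all_order all_algebra.
From mathcomp Require Import complex.
From mathcomp Require Import all_classical all_reals all_analysis.

Set Implicit Arguments.
Unset Strict Implicit.
Unset Printing Implicit Defensive.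

Import Order.TTheory GRing.Theory Num.Theory.
Import numFieldNormedType.Exports.

Local Open Scope classical_set_scope.
Local Open Scope ring_scope.

(* [R[i]^o] is [R[i]] with its topology and its structure of normed module over
   itself, so that [derivable f a 1] is complex differentiability of [f] at [a]. *)
Notation cplx R := (R[i]^o) (only parsing).

(* [None] is the point at infinity. *)
Notation sphere R := (one_point_compactification (R[i]^o)) (only parsing).

Section Sphere.
Variable R : realType.

Definition unit_disk : set (cplx R) := [set l | `|l| < 1].

(* The chart of the sphere on the plane; its value at infinity is arbitrary. *)
Definition sphere_coord (p : sphere R) : cplx R := if p is Some z then z else 0.

(* z |-> 1/z, exchanging 0 and infinity. *)
Definition sphere_inv (p : sphere R) : sphere R :=
  if p is Some z then (if z == 0 then None else Some z^-1) else Some 0.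

(* Continuity keeps [F] near [a] in the domain of the chart used at [F a]
   ([sphere_coord], or [sphere_coord \o sphere_inv] when [F a] is infinity). *)
Definition sphere_holomorphic_at (F : cplx R -> sphere R) (a : cplx R) : Prop :=
  {for a, continuous F} /\
  (if F a is Some _ then derivable (sphere_coord \o F) a 1
   else derivable (sphere_coord \o sphere_inv \o F) a 1).

(* [h l p] is only meaningful for [l] in the unit disk. *)
Definition holomorphic_motion (h : cplx R -> sphere R -> sphere R) : Prop :=
  [/\ forall p, {in unit_disk, forall l, sphere_holomorphic_at (h^~ p) l},
      {in unit_disk, forall l, injective (h l)}
    & forall p, h 0 p = p].

(* For [g l] fixing infinity, this is the set g(l, S), seen in the plane. *)
Definition motion_image (g : cplx R -> sphere R -> sphere R) (S : set (cplx R))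
    (l : cplx R) : set (cplx R) :=
  Some @^-1` (g l @` (Some @` S)).

(* Complex differentiability in the local coordinate z, or w = 1/z at infinity;
   required at every point of an open set, it is analyticity there. *)
Definition analytic_at (f : sphere R -> cplx R) (p : sphere R) : Prop :=
  if p is Some a then derivable (fun z : cplx R => f (Some z)) a 1
  else derivable (fun w : cplx R => f (sphere_inv (Some w))) 0 1.

Definition analytic_on (D : set (sphere R)) (f : sphere R -> cplx R) : Prop :=
  forall p, D p -> analytic_at f p.

Definition deriv_infty (f : sphere R -> cplx R) : cplx R :=
  lim (sphere_coord p * (f p - f None) @[p --> (None : sphere R)^']).

Definition sphere_setC (S : set (cplx R)) : set (sphere R) := ~` (Some @` S).

(* Elements of H^oo(D) are represented by functions on the whole sphere, whose
   values outside [D] are irrelevant. *)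
Definition Hinfty (D : set (sphere R)) : set (sphere R -> cplx R) :=
  [set f | [bounded f p | p in D] /\ analytic_on D f].

Definition Acont (D : set (sphere R)) : set (sphere R -> cplx R) :=
  [set f | continuous f /\ analytic_on D f].

(* [Normc.normc] is the modulus with values in [R] ([`|_|] has values in R[i]).
   For compact [S] the set below is bounded (Schwarz lemma at infinity), so that
   the real [sup] is its genuine least upper bound. *)
Definition analytic_capacity (S : set (cplx R)) : R :=
  sup [set Normc.normc (deriv_infty f) | f in
        [set f | Hinfty (sphere_setC S) f /\
                 forall p, sphere_setC S p -> `|f p| <= 1]].

Definition continuous_analytic_capacity (S : set (cplx R)) : R :=
  sup [set Normc.normc (deriv_infty f) | f in
        [set f | Acont (sphere_setC S) f /\
                 forall z : cplx R, `|f (Some z)| <= 1]].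

End Sphere.

(* Main.v *)
Require Import Defs.
From mathcomp Require Import all_boot all_order all_algebra.
From mathcomp Require Import complex.
From mathcomp Require Import all_classical all_reals all_analysis.
From mathcomp Require Import ring lra.

(** The set is a Cantor set of dimension 1 that is barely large enough to carry
    a bounded Cauchy transform, and the motion shrinks its pieces
    geometrically.

    Level n of the construction replaces a disc by four discs whose radii are
    smaller by the factor r_n = ((n + 16) / (n + 15))^2 / 4.  After n steps there
    are 4^n discs of radius of order 4^-n n^2.  Since the sum of the n^-2
    converges, the Cauchy transform of the equidistributed measure of the limit
    set K is bounded and continuous, behaves as 1/z at infinity, and is
    holomorphic off K; a small multiple of it shows that both capacities of K
    are positive ([capacity_cantor]).

    The map z |-> z - (l / 20) phi(z), where phi(z) = z - c near each of the four
    centres c and phi vanishes a little further away, is affine in l, and is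
    injective when |l| <= 1 because phi is 18-Lipschitz.  It multiplies the four
    discs by 1 - l / 20.  Applying it again inside each disc, at every level,
    defines a motion of the whole sphere that is explicit in l; it is injective
    because a point is recovered level by level ([motion_inj]), and holomorphic
    in l as a limit of polynomials in l with uniformly bounded second-order
    remainders ([motion_cdiff]).

    For real l in (0, 1) the discs of level n of the moved set have radius of
    order 4^-n n^2 (1 - l / 20)^n, hence the sum of their perimeters tends to 0.
    If f is holomorphic and bounded by 1 off the moved set, then Goursat's
    theorem on rectangles shows that the integral of f around a large square is
    the sum of its integrals around squares circumscribed to these discs, so it
    vanishes, and with it f'(oo) ([deriv_infty_moved_cantor]).  Both capacities
    are thus 0 for such l, arbitrarily close to the value 0 of the parameter at
    which they are positive.

    Limits of holomorphic functions are handled without Cauchy's formula: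
    a pointwise limit of functions whose second-order Taylor remainders at a
    point satisfy a common quadratic bound is differentiable at that point
    ([second_order_lim]). *)

Set Implicit Arguments.
Unset Strict Implicit.
Unset Printing Implicit Defensive.

Import Order.TTheory GRing.Theory Num.Theory.
Import numFieldNormedType.Exports.

Local Open Scope classical_set_scope.
Local Open Scope ring_scope.

Local Notation N := Normc.normc.
Local Notation Re := complex.Re.
Local Notation Im := complex.Im.

(** * Modulus, topology and differentiability on the complex plane *)

Section Modulus.
Variable R : realType.
Implicit Types (x y z : R[i]) (r : R).
Local Open Scope complex_scope.

Lemma normr_normc z : `|z| = (N z)%:C.
Proof. by rewrite normc_def; case: z. Qed.

Lemma normc_ge0 z : 0 <= N z.
Proof. by case: z => a b; rewrite sqrtr_ge0. Qed.

Lemma normc_eq0 z : (N z == 0) = (z == 0).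
Proof.
apply/eqP/eqP => [/Normc.eq0_normc //|->]; exact: Normc.normc0.
Qed.

Lemma normc_gt0 z : (0 < N z) = (z != 0).
Proof. by rewrite lt_def normc_eq0 normc_ge0 andbT. Qed.

Lemma normcD x y : N (x + y) <= N x + N y.
Proof. exact: le_normcD. Qed.

Lemma normcB x y : N (x - y) <= N x + N y.
Proof. by rewrite -(normcN y); exact: le_normcD. Qed.

Lemma normcBC x y : N (x - y) = N (y - x).
Proof. by rewrite -normcN opprB. Qed.

Lemma normc_dist_le x y z : N (x - z) <= N (x - y) + N (y - z).
Proof. by rewrite -(subrK y x) -addrA (le_trans (normcD _ _)) ?addrK. Qed.

Lemma normc_sub_ge x y : N x - N y <= N (x - y).
Proof. by rewrite lerBlDr -{1}(subrK y x) normcD. Qed.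

Lemma normc_real r : N r%:C = `|r|.
Proof. by rewrite /= expr0n addr0 sqrtr_sqr. Qed.

Lemma normc_i : N ('i : R[i]) = 1.
Proof. by rewrite /= expr0n expr1n add0r sqrtr1. Qed.

Lemma normcX z n : N (z ^+ n) = N z ^+ n.
Proof. by elim: n => [|n IH]; rewrite ?Normc.normc1 // !exprS Normc.normcM IH. Qed.

Lemma normc_conj z : N z^* = N z.
Proof. by case: z => a b /=; rewrite sqrrN. Qed.

Lemma Re_le_normc z : `|Re z| <= N z.
Proof.
case: z => a b /=; rewrite -sqrtr_sqr ler_wsqrtr // lerDl sqr_ge0 //.
Qed.

Lemma Im_le_normc z : `|Im z| <= N z.
Proof.
case: z => a b /=; rewrite -sqrtr_sqr ler_wsqrtr // lerDr sqr_ge0 //.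
Qed.

Lemma normc_le_ReIm z : N z <= `|Re z| + `|Im z|.
Proof.
case: z => a b /=; rewrite -[leRHS]ger0_norm ?addr_ge0 // -sqrtr_sqr.
rewrite ler_wsqrtr // sqrrD !real_normK ?num_real // -addrA lerD2l lerDr.
by rewrite mulrn_wge0 // mulr_ge0.
Qed.

Lemma normc_sqr z : N z ^+ 2 = Re z ^+ 2 + Im z ^+ 2.
Proof. by case: z => a b /=; rewrite sqr_sqrtr // addr_ge0 ?sqr_ge0. Qed.

Lemma normc_sum (I : Type) (s : seq I) (P : pred I) (F : I -> R[i]) :
  N (\sum_(i <- s | P i) F i) <= \sum_(i <- s | P i) N (F i).
Proof.
elim/big_rec2: _ => [|i y1 y2 _ h]; first by rewrite Normc.normc0.
by rewrite (le_trans (normcD _ _)) // lerD2l.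
Qed.

Lemma nbhs_cplxP (a : cplx R) (P : set (cplx R)) :
  nbhs a P <-> exists2 e : R, 0 < e & forall z, N (z - a) < e -> P z.
Proof.
split=> [/(@nbhs_normP _ R[i]^o)[[e1 e2] /=]|[e e0 h]].
  rewrite ltcE /= => /andP[/eqP-> e0] h; exists e1 => // z za; apply: h => /=.
  by rewrite normr_normc ltcR normcBC.
apply/(@nbhs_normP _ R[i]^o); exists e%:C; first by rewrite /= ltcR.
by move=> z /=; rewrite normr_normc ltcR normcBC; exact: h.
Qed.

Lemma nbhs_disc (z : cplx R) (e : R) : 0 < e -> nbhs z [set w | N (w - z) < e].
Proof. by move=> e0; apply/nbhs_cplxP; exists e. Qed.

Definition continuous_pt (f : R[i] -> R[i]) z := forall e : R, 0 < e ->
  exists2 d : R, 0 < d & forall w, N (w - z) < d -> N (f w - f z) < e.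

Lemma continuous_cplxP (f : cplx R -> cplx R) a :
  {for a, continuous f} <-> continuous_pt f a.
Proof.
split=> [fc e e0|h].
  have /nbhs_cplxP[d d0 hd] : nbhs a (f @^-1` [set z | N (z - f a) < e]).
    by apply: fc; apply/nbhs_cplxP; exists e.
  by exists d.
move=> A /nbhs_cplxP[e e0 hA]; apply/nbhs_cplxP; have [d d0 hd] := h e e0.
by exists d => // z /hd /hA.
Qed.

Lemma continuous_cplx_realP (f : cplx R -> R) a :
  {for a, continuous f} <->
  forall e : R, 0 < e -> exists2 d : R, 0 < d &
    forall z, N (z - a) < d -> `|f z - f a| < e.
Proof.
split=> [fc e e0|h].
  have /nbhs_cplxP[d d0 hd] : nbhs a (f @^-1` [set z | `|z - f a| < e]).
    apply: fc; apply/nbhs_ballP; exists e => //= z /=.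
    by rewrite /ball /= distrC.
  by exists d.
move=> A /nbhs_ballP[e /= e0 hA]; apply/nbhs_cplxP; have [d d0 hd] := h e e0.
by exists d => // z /hd zd; apply: hA; rewrite /ball /= distrC.
Qed.

(** Complex differentiability with real-valued moduli, in a division-free form
    that also makes sense for the increment 0. *)
Definition cdiff (f : R[i] -> R[i]) (a l : R[i]) :=
  forall e : R, 0 < e -> exists2 d : R, 0 < d &
    forall h, N h < d -> N (f (a + h) - f a - h * l) <= e * N h.

Lemma derivable_cdiffP (f : cplx R -> cplx R) (a : cplx R) :
  derivable f a 1 <-> exists l, cdiff f a l.
Proof.
split=> [/cvg_ex[/= l hl]|[l hl]].
  exists l => e e0.
  have /hl/nbhs_cplxP[d d0 hd] : nbhs l [set z | N (z - l) < e].
    by apply/nbhs_cplxP; exists e.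
  exists d => // h hlt.
  have [->|h0] := eqVneq h 0; first by rewrite addr0 subrr mul0r subr0 Normc.normc0 mulr0.
  have := hd h; rewrite subr0 => /(_ hlt h0) /=.
  rewrite /GRing.scale /= mulr1 => /ltW H.
  have -> : f (a + h) - f a - h * l = h * (h^-1 * (f (h + a) - f a) - l).
    by rewrite mulrBr mulrA divff // mul1r [h + a]addrC.
  by rewrite Normc.normcM mulrC ler_wpM2r // normc_ge0.
apply/cvg_ex; exists l => A /nbhs_cplxP[e e0 hA].
have [d d0 hd] := hl (e / 2) (divr_gt0 e0 (ltr0Sn _ 1)).
apply/nbhs_cplxP; exists d => // h; rewrite subr0 => hlt h0; apply: hA.
have := hd h hlt.
have -> : f (a + h) - f a - h * l = h * (h^-1 * (f (h + a) - f a) - l).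
  by rewrite mulrBr mulrA divff // mul1r [h + a]addrC.
have nh : 0 < N h by rewrite normc_gt0.
rewrite Normc.normcM mulrC ler_pM2r // /GRing.scale /= mulr1 => /le_lt_trans; apply.
by rewrite ltr_pdivrMr // mulr_natr mulr2n ltrDl.
Qed.

Lemma cdiff_continuous f a l : cdiff f a l -> continuous_pt f a.
Proof.
move=> fl e e0; have [d d0 hd] := fl 1 ltr01.
have l1 : 0 < 1 + N l by rewrite ltr_wpDr ?normc_ge0.
exists (Num.min d (e / (1 + N l))); first by rewrite lt_min d0 divr_gt0.
move=> z; rewrite lt_min => /andP[/hd]; rewrite subrKC mul1r.
rewrite ltr_pdivlMr // => h1 h2.
have := normcD (f z - f a - (z - a) * l) ((z - a) * l).
rewrite subrK Normc.normcM => h3; apply: le_lt_trans h3 _; apply: le_lt_trans h2.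
by rewrite mulrDr mulr1 lerD2r.
Qed.

Definition cdifferentiable f z := exists l, cdiff f z l.

Lemma cdifferentiable_cont f z : cdifferentiable f z -> continuous_pt f z.
Proof. by move=> [l /cdiff_continuous]. Qed.

(** Heine-Borel: the plane is the continuous image of R x R, so the closed disc
    sits inside a compact square. *)
Lemma closed_bounded_compact (r : R) (K : set (cplx R)) :
  closed K -> (forall z, K z -> N z <= r) -> compact K.
Proof.
move=> Kc Kr.
pose f (p : R * R) : cplx R := p.1 +i* p.2.
have fc : continuous f.
  move=> [a b] A /nbhs_cplxP[e e0 hA].
  exists (ball a (e / 2), ball b (e / 2)).
    by split; apply: nbhsx_ballx; rewrite divr_gt0.
  move=> [a' b'] /= [] /= ha hb; apply: hA.
  apply: le_lt_trans (normc_le_ReIm _) _ => /=.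
  by rewrite (splitr e) ltrD // distrC.
have : compact (f @` (`[-r, r] `*` `[-r, r])).
  apply: continuous_compact; first exact: continuous_subspaceT.
  by apply: compact_setX; exact: segment_compact.
move=> /(subclosed_compact Kc); apply => -[a b] /Kr zr.
exists (a, b) => //=.
have := le_trans (Re_le_normc _) zr; have := le_trans (Im_le_normc _) zr.
by rewrite /= !ler_norml !in_itv /= => -> ->.
Qed.

Lemma compact_normc_bounded (K : set (cplx R)) : compact K ->
  exists r : R, forall z, K z -> N z <= r.
Proof.
move=> Kc.
have : compact ((fun z : cplx R => N z) @` K).
  apply: continuous_compact => //; apply: continuous_subspaceT => a.
  apply/continuous_cplx_realP => e e0; exists e => // z za.
  apply: le_lt_trans za; rewrite ler_norml normc_sub_ge andbT.
  by rewrite lerNl opprB normcBC normc_sub_ge.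
move=> /compact_bounded[M [Mr hM]]; exists (M + 1) => z Kz.
have := hM (M + 1); rewrite ltrDl ltr01 => /(_ isT (N z)) /=.
by move=> /(_ (ex_intro2 _ _ z Kz erefl)) /(le_trans (ler_norm _)).
Qed.

End Modulus.

(** * Integrals of complex-valued functions on an interval *)

Section Integral.
Variable R : realType.
Implicit Types (a b c d t r : R) (z w : R[i]).
Local Open Scope complex_scope.
Local Notation mu := (@lebesgue_measure R).

Definition path_continuous a b (g : R -> R[i]) :=
  forall t, a <= t <= b -> forall e : R, 0 < e -> exists2 d, 0 < d &
    forall s, `|s - t| < d -> N (g s - g t) < e.

Definition cintegral a b (g : R -> R[i]) : R[i] :=
  (\int[mu]_(t in `[a, b]) Re (g t)) +i* (\int[mu]_(t in `[a, b]) Im (g t)).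

(** Re and Im are the intended p; the Lipschitz condition transfers continuity
    from g to the real integrand. *)
Lemma path_integrable (p : R[i] -> R) a b g :
  (forall x y, `|p x - p y| <= N (x - y)) -> path_continuous a b g ->
  mu.-integrable `[a, b] (EFin \o (fun t => p (g t))).
Proof.
move=> pl gc; apply: continuous_compact_integrable; first exact: segment_compact.
apply: continuous_in_subspaceT => t; rewrite inE /= in_itv /= => tab.
apply/cvgrPdist_lt => e e0; have [d d0 hd] := gc t tab e e0.
exists d => //= s; rewrite /ball_ /= distrC => sd.
by rewrite distrC; apply: le_lt_trans (pl _ _) _; exact: hd.
Qed.

Lemma Re_dist z w : `|Re z - Re w| <= N (z - w).
Proof. by case: z w => [? ?] [? ?]; exact: (Re_le_normc (_ +i* _)). Qed.

Lemma Im_dist z w : `|Im z - Im w| <= N (z - w).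
Proof. by case: z w => [? ?] [? ?]; exact: (Im_le_normc (_ +i* _)). Qed.

Let ReI a b g (gc : path_continuous a b g) := path_integrable Re_dist gc.
Let ImI a b g (gc : path_continuous a b g) := path_integrable Im_dist gc.

Lemma eq_cintegral a b f g : (forall t, a <= t <= b -> f t = g t) ->
  cintegral a b f = cintegral a b g.
Proof.
by move=> fg; congr (_ +i* _); apply: eq_Rintegral => t; rewrite inE /= in_itv /= => /fg ->.
Qed.

Lemma cintegral_split a b c g : a <= b -> b <= c -> path_continuous a c g ->
  cintegral a c g = cintegral a b g + cintegral b c g.
Proof.
move=> ab bc gc.
have H (p : R -> R) : mu.-integrable `[a, c] (EFin \o p) ->
  \int[mu]_(t in `[a, c]) p t = \int[mu]_(t in `[a, b]) p t + \int[mu]_(t in `[b, c]) p t.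
  move=> pI.
  have := Rintegral_itvB pI (x := b); rewrite !bnd_simp => /(_ ab bc).
  rewrite (@Rintegral_itv_obnd_cbnd R b (BRight c) p); last first.
    by apply: integrableS pI => //; apply: subset_itvr; rewrite bnd_simp.
  by move=> <-; rewrite addrC subrK.
by rewrite /cintegral; simpc; rewrite -!H //; [exact: ImI|exact: ReI].
Qed.

Lemma cintegralD a b f g : path_continuous a b f -> path_continuous a b g ->
  cintegral a b (fun t => f t + g t) = cintegral a b f + cintegral a b g.
Proof.
move=> fc gc; rewrite /cintegral; simpc.
rewrite -RintegralD //; [|exact: ReI|exact: ReI].
rewrite -RintegralD //; [|exact: ImI|exact: ImI].
by congr (_ +i* _); apply: eq_Rintegral => t _ /=; case: (f t) (g t) => [? ?] [].
Qed.

Lemma cintegralZ a b z f : path_continuous a b f ->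
  cintegral a b (fun t => z * f t) = z * cintegral a b f.
Proof.
move=> fc; rewrite /cintegral; case: z => x y; simpc.
rewrite -!RintegralZl //; try by [exact: ReI|exact: ImI].
rewrite -RintegralD //; last 2 first.
- by apply: (@integrableZl _ _ _ mu _ _ x) (ImI fc).
- by apply: (@integrableZl _ _ _ mu _ _ y) (ReI fc).
rewrite -RintegralB //; last 2 first.
- by apply: (@integrableZl _ _ _ mu _ _ x) (ReI fc).
- by apply: (@integrableZl _ _ _ mu _ _ y) (ImI fc).
by congr (_ +i* _); apply: eq_Rintegral => t _ /=; case: (f t).
Qed.

Lemma fine_lebesgue_itv a b : a <= b -> fine (mu `[a, b]%classic) = b - a.
Proof.
rewrite lebesgue_measure_itv /= lte_fin le_eqVlt => /predU1P[->|->] //.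
by rewrite ltxx subrr.
Qed.

Lemma cintegral_cst a b z : a <= b -> cintegral a b (fun=> z) = z * (b - a)%:C.
Proof.
move=> ab; rewrite /cintegral !Rintegral_cst //.
by rewrite fine_lebesgue_itv //; case: z => x y; simpc.
Qed.

Lemma cintegral_id a b : a <= b ->
  cintegral a b (fun t => t%:C) = ((b ^+ 2 - a ^+ 2) / 2)%:C.
Proof.
rewrite le_eqVlt => /predU1P[->|ab].
  by rewrite subrr mul0r /cintegral set_itv1 !Rintegral_set1.
rewrite /cintegral /= Rintegral_cst //= mul0r; congr (_ +i* _).
rewrite /Rintegral (@continuous_FTC2 R _ (fun x => x ^+ 2 / 2)) //=.
- by rewrite -mulrBl.
- by apply: continuous_subspaceT => x; exact: cvg_id.
- have D (x : R) : derivable (fun x : R => x ^+ 2 / 2) x 1.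
    by apply: derivableM.
  have cD (x : R) : (fun x : R => x ^+ 2 / 2) y @[y --> x] --> x ^+ 2 / 2.
    by apply: cvgM; [apply: exprn_continuous|exact: cvg_cst].
  split=> [x _||]; first exact: D.
  + exact: cvg_at_right_filter.
  + exact: cvg_at_left_filter.
- move=> x _; rewrite derive1E deriveM // derive_cst scaler0 add0r exp_derive /=.
  by rewrite /GRing.scale /= expr1 !mulr1 -mulr_natl mulrA mulVf ?mul1r ?pnatr_eq0.
Qed.

(** The factor 2 comes from estimating real and imaginary parts separately. *)
Lemma cintegral_le a b g M : a <= b -> path_continuous a b g ->
  (forall t, a <= t <= b -> N (g t) <= M) ->
  N (cintegral a b g) <= 2 * M * (b - a).
Proof.
move=> ab gc gM; apply: le_trans (normc_le_ReIm _) _ => /=.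
have H (p : R[i] -> R) : (forall z, `|p z| <= N z) ->
    (forall x y, `|p x - p y| <= N (x - y)) ->
    `|\int[mu]_(t in `[a, b]) p (g t)| <= M * (b - a).
  move=> pN pl; apply: le_trans (le_normr_Rintegral _ (path_integrable pl gc)) _ => //.
  have -> : M * (b - a) = \int[mu]_(t in `[a, b]) (cst M t).
    by rewrite Rintegral_cst // fine_lebesgue_itv.
  apply: le_Rintegral => //.
  - apply: (@path_integrable (fun z => `|p z|)) gc => x y.
    exact: le_trans (ler_dist_dist _ _) (pl x y).
  - have Mc : path_continuous a b (fun=> M%:C).
      by move=> t _ e e0; exists 1 => // s _; rewrite subrr Normc.normc0.
    exact: (path_integrable Re_dist Mc).
  - by move=> t /=; rewrite in_itv /= => /gM; exact: le_trans (pN _).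
rewrite mulrAC mulr_natl mulr2n mulrC mulrDr lerD //.
  by rewrite H //; [exact: Re_le_normc|exact: Re_dist].
by rewrite H //; [exact: Im_le_normc|exact: Im_dist].
Qed.

End Integral.

(** * Integrals around rectangles and the theorem of Goursat *)

Section Goursat.
Variable R : realType.
Implicit Types (a b c d t r : R) (z w : R[i]) (f : R[i] -> R[i]).
Local Open Scope complex_scope.

Lemma geometric_small (M q e : R) : 0 <= q < 1 -> 0 < e ->
  exists n0, forall n, (n0 <= n)%N -> M * q ^+ n < e.
Proof.
move=> /andP[q0 q1] e0.
have : geometric M q @ \oo --> 0 by apply: cvg_geometric; rewrite ger0_norm.
move=> /cvgrPdist_lt /(_ e e0)[n0 _ h]; exists n0 => n n0n.
have := h n n0n; rewrite /= sub0r normrN; exact: le_lt_trans (ler_norm _).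
Qed.

(** Bisection principle.  If P failed for a rectangle, it would fail for one of
    its quarters, then for a quarter of that one, and so on; the nested
    rectangles shrink to a point, near which P holds by assumption. *)
Lemma rect_bisect (P : R -> R -> R -> R -> Prop) :
  (forall a b c d, a <= b -> c <= d ->
     P a ((a + b) / 2) c ((c + d) / 2) -> P ((a + b) / 2) b c ((c + d) / 2) ->
     P a ((a + b) / 2) ((c + d) / 2) d -> P ((a + b) / 2) b ((c + d) / 2) d ->
     P a b c d) ->
  forall a b c d, a <= b -> c <= d ->
  (forall x y, a <= x <= b -> c <= y <= d -> exists2 e : R, 0 < e &
     forall a' b' c' d', a' <= x <= b' -> c' <= y <= d' ->
       a <= a' -> b' <= b -> c <= c' -> d' <= d ->
       b' - a' < e -> d' - c' < e -> P a' b' c' d') ->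
  P a b c d.
Proof.
move=> Pbis a b c d ab cd Ploc; apply: contrapT => nP.
pose step (Q : R * R * R * R) := let: (a, b, c, d) := Q in
  let m := (a + b) / 2 in let n := (c + d) / 2 in
  if `[< ~ P a m c n >] then (a, m, c, n) else
  if `[< ~ P m b c n >] then (m, b, c, n) else
  if `[< ~ P a m n d >] then (a, m, n, d) else (m, b, n, d).
pose u n := iter n step (a, b, c, d).
pose A n := (u n).1.1.1; pose B n := (u n).1.1.2.
pose C n := (u n).1.2; pose D n := (u n).2.
have uE n : u n = (A n, B n, C n, D n) by rewrite /A /B /C /D; case: (u n) => [[[? ?] ?] ?].
have main n : [/\ ~ P (A n) (B n) (C n) (D n),
    A n <= B n /\ B n - A n = (b - a) * (2^-1) ^+ n,
    C n <= D n /\ D n - C n = (d - c) * (2^-1) ^+ n,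
    A n <= A n.+1 /\ B n.+1 <= B n & C n <= C n.+1 /\ D n.+1 <= D n].
  have S k : A k <= B k -> C k <= D k ->
    [/\ ~ P (A k) (B k) (C k) (D k) -> ~ P (A k.+1) (B k.+1) (C k.+1) (D k.+1),
      A k.+1 <= B k.+1 /\ B k.+1 - A k.+1 = (B k - A k) / 2,
      C k.+1 <= D k.+1 /\ D k.+1 - C k.+1 = (D k - C k) / 2,
      A k <= A k.+1 /\ B k.+1 <= B k & C k <= C k.+1 /\ D k.+1 <= D k].
    move=> AB CD.
    have : u k.+1 = step (u k) by [].
    rewrite (uE k.+1) uE /step.
    case: asboolP => [h|/contrapT h1]; first by case=> -> -> -> ->; split=> //; do ?split; lra.
    case: asboolP => [h|/contrapT h2]; first by case=> -> -> -> ->; split=> //; do ?split; lra.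
    case: asboolP => [h|/contrapT h3]; case=> -> -> -> ->; first by split=> //; do ?split; lra.
    by split; [move=> nPk h; apply: nPk; exact: Pbis| | | |]; do ?split; lra.
  suff [] : [/\ ~ P (A n) (B n) (C n) (D n),
    A n <= B n /\ B n - A n = (b - a) * (2^-1) ^+ n &
    C n <= D n /\ D n - C n = (d - c) * (2^-1) ^+ n].
    by move=> h1 [h2 h2'] [h3 h3']; have [] := S n h2 h3.
  elim: n => [|n [IH1 [IH2 IH2'] [IH3 IH3']]].
    by rewrite !expr0 !mulr1.
  have [h1 [h2 h2'] [h3 h3'] _ _] := S n IH2 IH3; split; first exact: h1.
    by rewrite h2' IH2' exprS; split => //; rewrite mulrAC -mulrA.
  by rewrite h3' IH3' exprS; split => //; rewrite mulrAC -mulrA.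
have mono (X Y : nat -> R) : (forall n, X n <= Y n) -> (forall n, X n <= X n.+1) ->
    (forall n, Y n.+1 <= Y n) -> exists x, forall n, X n <= x <= Y n.
  move=> XY Xi Yd.
  have Xm m n : (m <= n)%N -> X m <= X n.
    by move=> /subnK <-; elim: (n - m)%N => // k IH; rewrite (le_trans IH) ?addSn.
  have Ym m n : (m <= n)%N -> Y n <= Y m.
    by move=> /subnK <-; elim: (n - m)%N => // k IH; rewrite (le_trans _ IH) ?addSn.
  have XYm m n : X m <= Y n.
    apply: le_trans (Xm m (maxn m n) _) _; first exact: leq_maxl.
    by apply: le_trans (XY _) _; apply: Ym; exact: leq_maxr.
  exists (sup (range X)) => n; apply/andP; split.
    apply: ub_le_sup; last by exists n.
    by exists (Y 0%N) => _ [k _ <-].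
  by apply: ge_sup; [exists (X 0%N); exists 0%N|move=> _ [k _ <-]].
have [x xAB] : exists x, forall n, A n <= x <= B n.
  by apply: mono => n; have [_ [? _] _ [? ?] _] := main n.
have [y yCD] : exists x, forall n, C n <= x <= D n.
  by apply: mono => n; have [_ _ [? _] _ [? ?]] := main n.
have [e e0 he] := Ploc x y (xAB 0%N) (yCD 0%N).
have q01 : 0 <= (2^-1 : R) < 1 by lra.
have [n1 h1] := geometric_small (b - a) q01 e0.
have [n2 h2] := geometric_small (d - c) q01 e0.
have incl n : [/\ a <= A n, B n <= b, c <= C n & D n <= d].
  elim: n => [|n [i1 i2 i3 i4]]; first by split.
  by have [_ _ _ [? ?] [? ?]] := main n; split; lra.
have [nPn [_ BA] [_ DC] _ _] := main (maxn n1 n2).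
have [i1 i2 i3 i4] := incl (maxn n1 n2).
apply: nPn; apply: he => //; first by rewrite BA h1 // leq_maxl.
by rewrite DC h2 // leq_maxr.
Qed.

(** Counterclockwise boundary integral of f over the rectangle [a, b] x [c, d]. *)
Definition rect_integral f a b c d : R[i] :=
  cintegral a b (fun t => f (t +i* c)) - cintegral a b (fun t => f (t +i* d)) +
  'i * (cintegral c d (fun t => f (b +i* t)) - cintegral c d (fun t => f (a +i* t))).

Definition hcont f a b c := forall t, a <= t <= b -> continuous_pt f (t +i* c).
Definition vcont f a c d := forall t, c <= t <= d -> continuous_pt f (a +i* t).

Lemma hcont_path f a b c : hcont f a b c -> path_continuous a b (fun t => f (t +i* c)).
Proof.
move=> fc t tab e e0; have [r r0 hr] := fc t tab e e0; exists r => // s st.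
by apply: hr; simpc; rewrite /= expr0n addr0 sqrtr_sqr.
Qed.

Lemma vcont_path f a c d : vcont f a c d -> path_continuous c d (fun t => f (a +i* t)).
Proof.
move=> fc t tab e e0; have [r r0 hr] := fc t tab e e0; exists r => // s st.
by apply: hr; simpc; rewrite /= expr0n add0r sqrtr_sqr.
Qed.

Lemma rect_integral_splitx f a m b c d : a <= m -> m <= b ->
  hcont f a b c -> hcont f a b d ->
  rect_integral f a b c d = rect_integral f a m c d + rect_integral f m b c d.
Proof.
move=> am mb /hcont_path hc /hcont_path hd; rewrite /rect_integral.
by rewrite (cintegral_split am mb hc) (cintegral_split am mb hd); ring.
Qed.

Lemma rect_integral_splity f a b c m d : c <= m -> m <= d ->
  vcont f a c d -> vcont f b c d ->
  rect_integral f a b c d = rect_integral f a b c m + rect_integral f a b m d.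
Proof.
move=> am mb /vcont_path hc /vcont_path hd; rewrite /rect_integral.
by rewrite (cintegral_split am mb hc) (cintegral_split am mb hd); ring.
Qed.

Definition boundary_cont f a b c d :=
  [/\ hcont f a b c, hcont f a b d, vcont f a c d & vcont f b c d].

Lemma rect_integralD f g a b c d : boundary_cont f a b c d -> boundary_cont g a b c d ->
  rect_integral (fun z => f z + g z) a b c d =
  rect_integral f a b c d + rect_integral g a b c d.
Proof.
move=> [/hcont_path f1 /hcont_path f2 /vcont_path f3 /vcont_path f4].
move=> [/hcont_path g1 /hcont_path g2 /vcont_path g3 /vcont_path g4].
rewrite /rect_integral (cintegralD f1 g1) (cintegralD f2 g2) (cintegralD f3 g3).
by rewrite (cintegralD f4 g4); ring.
Qed.

Lemma rect_integralZ z f a b c d : boundary_cont f a b c d ->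
  rect_integral (fun w => z * f w) a b c d = z * rect_integral f a b c d.
Proof.
move=> [/hcont_path f1 /hcont_path f2 /vcont_path f3 /vcont_path f4].
rewrite /rect_integral (cintegralZ _ f1) (cintegralZ _ f2) (cintegralZ _ f3).
by rewrite (cintegralZ _ f4); ring.
Qed.

Lemma path_continuous_cst a b z : path_continuous a b (fun=> z).
Proof. by move=> t _ e e0; exists 1 => // s _; rewrite subrr Normc.normc0. Qed.

Lemma path_continuous_id a b : path_continuous a b (fun t => t%:C).
Proof. by move=> t _ e e0; exists e => // s; rewrite -rmorphB normc_real. Qed.

Lemma path_continuousZ a b z g : path_continuous a b g ->
  path_continuous a b (fun t => z * g t).
Proof.
move=> gc t tab e e0; have z1 : 0 < 1 + N z by rewrite ltr_wpDr ?normc_ge0.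
have [r r0 hr] := gc t tab (e / (1 + N z)) (divr_gt0 e0 z1); exists r => // s /hr.
rewrite -mulrBr Normc.normcM ltr_pdivlMr // => h; apply: le_lt_trans h.
by rewrite mulrDr mulr1 mulrC lerDr normc_ge0.
Qed.

Lemma cintegral_affine a b z w : a <= b ->
  cintegral a b (fun t => z + w * t%:C) =
  z * (b - a)%:C + w * ((b ^+ 2 - a ^+ 2) / 2)%:C.
Proof.
move=> ab; rewrite cintegralD.
- by rewrite cintegral_cst // cintegralZ ?cintegral_id //; exact: path_continuous_id.
- exact: path_continuous_cst.
- by apply: path_continuousZ; exact: path_continuous_id.
Qed.

(** The case of the Cauchy theorem that can be computed, and to which Goursat's
    theorem reduces the general one. *)
Lemma rect_integral_affine a b c d z w : a <= b -> c <= d ->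
  rect_integral (fun u => z + w * u) a b c d = 0.
Proof.
move=> ab cd; rewrite /rect_integral.
have hE y : (fun t : R => z + w * (t +i* y)) = (fun t => (z + w * (0 +i* y)) + w * t%:C).
  apply/funext => t; rewrite -addrA -mulrDr; congr (_ + _ * _); by simpc.
have vE x : (fun t : R => z + w * (x +i* t)) = (fun t => (z + w * x%:C) + (w * 'i) * t%:C).
  apply/funext => t; rewrite -addrA -mulrA -mulrDr; congr (_ + _ * _).
  by simpc.
rewrite !hE !vE !cintegral_affine //.
case: z w {hE vE} => z1 z2 [w1 w2].
apply/eqP; rewrite eq_complex; simpc => /=.
apply/andP; split; apply/eqP; by ring.
Qed.

Lemma rect_integral_le f a b c d M : a <= b -> c <= d -> boundary_cont f a b c d ->
  (forall x, a <= x <= b -> N (f (x +i* c)) <= M /\ N (f (x +i* d)) <= M) ->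
  (forall y, c <= y <= d -> N (f (a +i* y)) <= M /\ N (f (b +i* y)) <= M) ->
  N (rect_integral f a b c d) <= 4 * M * ((b - a) + (d - c)).
Proof.
move=> ab cd [/hcont_path f1 /hcont_path f2 /vcont_path f3 /vcont_path f4] hM vM.
have h1 := cintegral_le ab f1 (fun t tab => (hM t tab).1).
have h2 := cintegral_le ab f2 (fun t tab => (hM t tab).2).
have h3 := cintegral_le cd f3 (fun t tab => (vM t tab).1).
have h4 := cintegral_le cd f4 (fun t tab => (vM t tab).2).
rewrite /rect_integral; apply: le_trans (normcD _ _) _.
rewrite Normc.normcM.
rewrite normc_i.
have := normcB (cintegral a b (fun t => f (t +i* c))) (cintegral a b (fun t => f (t +i* d))).
have := normcB (cintegral c d (fun t => f (b +i* t))) (cintegral c d (fun t => f (a +i* t))).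
lra.
Qed.

Lemma continuous_ptD f g z : continuous_pt f z -> continuous_pt g z ->
  continuous_pt (fun w => f w + g w) z.
Proof.
move=> fz gz e e0; have [r r0 hr] := fz (e / 2) ltac:(lra).
have [s s0 hs] := gz (e / 2) ltac:(lra).
exists (Num.min r s); first by rewrite lt_min r0.
move=> w; rewrite lt_min => /andP[/hr h1 /hs h2].
have -> : f w + g w - (f z + g z) = (f w - f z) + (g w - g z) by ring.
by apply: le_lt_trans (normcD _ _) _; lra.
Qed.

Lemma continuous_ptZ u f z : continuous_pt f z -> continuous_pt (fun w => u * f w) z.
Proof.
move=> fz e e0; have u1 : 0 < 1 + N u by rewrite ltr_wpDr ?normc_ge0.
have [d d0 hd] := fz _ (divr_gt0 e0 u1); exists d => // w /hd.
rewrite -mulrBr Normc.normcM ltr_pdivlMr // => h; apply: le_lt_trans h.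
by rewrite mulrDr mulr1 mulrC lerDr normc_ge0.
Qed.

Lemma continuous_pt_cst u z : continuous_pt (fun=> u) z.
Proof. by move=> e e0; exists 1 => // w _; rewrite subrr Normc.normc0. Qed.

Lemma continuous_pt_id z : continuous_pt id z.
Proof. by move=> e e0; exists e. Qed.

Lemma continuous_pt_affine u v z : continuous_pt (fun w => u + v * w) z.
Proof.
apply: continuous_ptD; first exact: continuous_pt_cst.
by apply: continuous_ptZ; exact: continuous_pt_id.
Qed.

Lemma rect_boundary_cont f a b c d : a <= b -> c <= d ->
  (forall x y, a <= x <= b -> c <= y <= d -> continuous_pt f (x +i* y)) ->
  boundary_cont f a b c d.
Proof. by move=> ab cd fc; split=> t tab; apply: fc; rewrite ?lexx ?ab ?cd. Qed.

(** The bound |integral| <= e (half-perimeter)^2 is inherited from the quarters of a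
    rectangle, because their half-perimeters are halved; it holds for small
    rectangles at each point p since f differs there from its affine
    approximation, whose integral vanishes, by o(|z - p|). *)
Theorem goursat f a b c d : a <= b -> c <= d ->
  (forall x y, a <= x <= b -> c <= y <= d -> exists l, cdiff f (x +i* y) l) ->
  rect_integral f a b c d = 0.
Proof.
move=> ab cd fd.
pose P0 := (b - a) + (d - c).
suff H e : 0 < e -> N (rect_integral f a b c d) <= e * P0 ^+ 2.
  apply: Normc.eq0_normc; apply/eqP; rewrite eq_le normc_ge0 andbT.
  apply/ler_addgt0Pr => e e0; rewrite add0r.
  have p1 : 0 < 1 + P0 ^+ 2 by rewrite ltr_wpDr // sqr_ge0.
  apply: le_trans (H (e / (1 + P0 ^+ 2)) (divr_gt0 e0 p1)) _.
  by rewrite mulrAC ler_pdivrMr // ler_pM2l // lerDr.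
move=> e0.
pose P a' b' c' d' := a <= a' -> b' <= b -> c <= c' -> d' <= d ->
  N (rect_integral f a' b' c' d') <= e * ((b' - a') + (d' - c')) ^+ 2.
suff : P a b c d by apply.
have fc x y : a <= x <= b -> c <= y <= d -> continuous_pt f (x +i* y).
  by move=> hx hy; have [l /cdiff_continuous] := fd x y hx hy.
apply: rect_bisect => // [a1 b1 c1 d1 ab1 cd1 P1 P2 P3 P4 h1 h2 h3 h4|x y hx hy].
  set m := (a1 + b1) / 2 in P1 P2 P3 P4; set n := (c1 + d1) / 2 in P1 P2 P3 P4.
  have mE : m = (a1 + b1) / 2 by []. have nE : n = (c1 + d1) / 2 by [].
  rewrite (@rect_integral_splitx f a1 m) //; try lra; last 2 first.
    by move=> t ht; apply: fc; lra.
    by move=> t ht; apply: fc; lra.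
  rewrite (@rect_integral_splity f a1 m c1 n); try lra; last 2 first.
    by move=> t ht; apply: fc; lra.
    by move=> t ht; apply: fc; lra.
  rewrite (@rect_integral_splity f m b1 c1 n); try lra; last 2 first.
    by move=> t ht; apply: fc; lra.
    by move=> t ht; apply: fc; lra.
  have [am mb nc nd] : [/\ a <= m, m <= b, c <= n & n <= d] by split; lra.
  have {}P1 := P1 h1 mb h3 nd; have {}P2 := P2 am h2 h3 nd.
  have {}P3 := P3 h1 mb nc h4; have {}P4 := P4 am h2 nc h4.
  set r1 := rect_integral _ _ _ _ _ in P1 *; set r2 := rect_integral _ _ _ _ _ in P2 *.
  set r3 := rect_integral _ _ _ _ _ in P3 *; set r4 := rect_integral _ _ _ _ _ in P4 *.
  have E : (m - a1) + (n - c1) = (b1 - a1 + (d1 - c1)) / 2 by lra.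
  rewrite E in P1; have E2 : (b1 - m) + (n - c1) = (b1 - a1 + (d1 - c1)) / 2 by lra.
  rewrite E2 in P2; have E3 : (m - a1) + (d1 - n) = (b1 - a1 + (d1 - c1)) / 2 by lra.
  rewrite E3 in P3; have E4 : (b1 - m) + (d1 - n) = (b1 - a1 + (d1 - c1)) / 2 by lra.
  rewrite E4 in P4.
  have -> : e * (b1 - a1 + (d1 - c1)) ^+ 2 = 4 * (e * ((b1 - a1 + (d1 - c1)) / 2) ^+ 2) by field.
  have := normcD (r1 + r3) (r2 + r4); have := normcD r1 r3; have := normcD r2 r4.
  lra.
have [l hl] := fd x y hx hy.
have [r r0 hr] := hl (e / 4) ltac:(lra).
exists (r / 2); first lra.
move=> a1 b1 c1 d1 hx1 hy1 h1 h2 h3 h4 br dr _ _ _ _.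
set p := x +i* y in hl hr.
(* the error of the affine approximation of f at p *)
pose g z := f z - (f p - l * p + l * z).
have gc : boundary_cont g a1 b1 c1 d1.
  apply: rect_boundary_cont => [||s t hs ht]; try lra.
  have -> : g = fun z => f z + ((- f p + l * p) + (- l) * z).
    by apply/funext => z; rewrite /g; ring.
  by apply: continuous_ptD; [apply: fc; lra|exact: continuous_pt_affine].
have fE : f = fun z => g z + ((f p - l * p) + l * z).
  by apply/funext => z; rewrite /g; ring.
have ac : boundary_cont (fun z => (f p - l * p) + l * z) a1 b1 c1 d1.
  by apply: rect_boundary_cont => [||s t hs ht]; try lra; exact: continuous_pt_affine.
rewrite fE rect_integralD // rect_integral_affine; try lra.
rewrite addr0.
have bd s t : a1 <= s <= b1 -> c1 <= t <= d1 ->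
    N (g (s +i* t)) <= e / 4 * ((b1 - a1) + (d1 - c1)).
  move=> hs ht.
  have Np : N ((s +i* t) - p) <= (b1 - a1) + (d1 - c1).
    apply: le_trans (normc_le_ReIm _) _; rewrite /p; simpc => /=.
    by rewrite lerD // ler_norml; lra.
  have := hr ((s +i* t) - p); rewrite subrKC.
  have -> : f (s +i* t) - f p - (s +i* t - p) * l = g (s +i* t) by rewrite /g; ring.
  move=> h; apply: le_trans (h _) _; first by lra.
  by rewrite ler_wpM2l //; lra.
have -> : e * (b1 - a1 + (d1 - c1)) ^+ 2 =
   4 * (e / 4 * (b1 - a1 + (d1 - c1))) * (b1 - a1 + (d1 - c1)) by field.
by apply: rect_integral_le => //; try lra; move=> t ht; split; apply: bd; lra.
Qed.

End Goursat.

(** * The residue at infinity *)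

Section RectCauchy.
Variable R : realType.
Implicit Types (a b c d t r : R) (z w : R[i]) (f : R[i] -> R[i]).
Local Open Scope complex_scope.

(** The frame between the two rectangles is cut into four rectangles on which
    Goursat's theorem applies: full-height strips on the left and on the right,
    then the pieces below and above the inner rectangle. *)
Lemma rect_integral_shrink f a b c d a' b' c' d' :
  a <= a' -> a' <= b' -> b' <= b -> c <= c' -> c' <= d' -> d' <= d ->
  (forall x y, a <= x <= b -> c <= y <= d -> ~~ (a' < x < b') || ~~ (c' < y < d') ->
     cdifferentiable f (x +i* y)) ->
  rect_integral f a b c d = rect_integral f a' b' c' d'.
Proof.
move=> aa ab bb cc cd dd fd.
have fc x y : a <= x <= b -> c <= y <= d -> ~~ (a' < x < b') || ~~ (c' < y < d') ->
    continuous_pt f (x +i* y).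
  by move=> hx hy hxy; apply: cdifferentiable_cont; exact: fd.
have [e1 e2 e3 e4] : [/\ a' <= b, c' <= d, a <= b & c <= d] by split; lra.
rewrite (@rect_integral_splitx _ f a a' b)//; last 2 first.
- by move=> t ht; apply: fc; lra.
- by move=> t ht; apply: fc; lra.
rewrite (@rect_integral_splitx _ f a' b' b)//; last 2 first.
- by move=> t ht; apply: fc; lra.
- by move=> t ht; apply: fc; lra.
rewrite (@rect_integral_splity _ f a' b' c c' d)//; last 2 first.
- by move=> t ht; apply: fc; lra.
- by move=> t ht; apply: fc; lra.
rewrite (@rect_integral_splity _ f a' b' c' d' d)//; last 2 first.
- by move=> t ht; apply: fc; lra.
- by move=> t ht; apply: fc; lra.
rewrite (@goursat _ f a a')//; last by move=> x y hx hy; apply: fd; lra.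
rewrite (@goursat _ f b' b)//; last by move=> x y hx hy; apply: fd; lra.
rewrite (@goursat _ f a' b' c c')//; last by move=> x y hx hy; apply: fd; lra.
rewrite (@goursat _ f a' b' d' d)//; last by move=> x y hx hy; apply: fd; lra.
by rewrite !add0r !addr0.
Qed.

Lemma continuous_pt_inv z : z != 0 -> continuous_pt (fun w => w^-1) z.
Proof.
move=> z0 e e0; have nz : 0 < N z by rewrite normc_gt0.
have n2 : 0 < N z ^+ 2 by rewrite exprn_gt0.
exists (Num.min (N z / 2) (e * N z ^+ 2 / 2)).
  by rewrite lt_min !divr_gt0 // mulr_gt0.
move=> w; rewrite lt_min => /andP[h1 h2].
have wz : N z / 2 < N w.
  by have := normc_sub_ge z w; rewrite normcBC => h3; lra.
have nw : 0 < N w by lra.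
have w0 : w != 0 by rewrite -normc_gt0.
have -> : w^-1 - z^-1 = (z - w) / (w * z) by field; rewrite w0 z0.
rewrite Normc.normcM Normc.normcV Normc.normcM normcBC ltr_pdivrMr ?mulr_gt0 //.
apply: (lt_le_trans h2).
have -> : e * N z ^+ 2 / 2 = e * (N z / 2 * N z) by rewrite expr2; field.
by rewrite ler_pM2l // ler_pM2r //; lra.
Qed.

(** The integral is 2 pi i; a lower bound is enough.  Opposite sides combine to
    the integrand 2 r / (t^2 + r^2), which is at least 1 / r on [- r, r], and the
    two pairs of sides contribute equally. *)
Lemma rect_integral_inv r : 0 < r ->
  4 <= N (rect_integral (fun z => z^-1) (- r) r (- r) r).
Proof.
move=> r0.
pose v t : R := (2 * r) / (t ^+ 2 + r ^+ 2).
have sq0 t : t ^+ 2 + r ^+ 2 != 0 by rewrite gt_eqF // ltr_wpDl ?sqr_ge0 ?exprn_gt0.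
have r20 : 0 < r ^+ 2 by rewrite exprn_gt0.
have nz1 t s : s != 0 -> t +i* s != 0 by move=> s0; rewrite eq_complex /= negb_and s0 orbT.
have nz2 t s : s != 0 -> s +i* t != 0 by move=> s0; rewrite eq_complex /= negb_and s0.
have rn : r != 0 by rewrite gt_eqF. have rn' : - r != 0 by rewrite oppr_eq0.
have cont : boundary_cont (fun z : R[i] => z^-1) (- r) r (- r) r.
  by split=> t _; apply: continuous_pt_inv; first [by apply: nz1|by apply: nz2].
have [/hcont_path h1 /hcont_path h2 /vcont_path h3 /vcont_path h4] := cont.
have invE x y : (x +i* y)^-1 = (x / (x ^+ 2 + y ^+ 2)) -i* (y / (x ^+ 2 + y ^+ 2)) :> R[i] by [].
have vc : path_continuous (- r) r (fun t => (v t)%:C).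
  have : path_continuous (-r) r (fun t : R => (r +i* t)^-1 + (-1) * (- r +i* t)^-1).
    move=> t ht; have := path_continuousZ (-1) h3 ht.
    move: (h4 t ht) => g4 g3 e e0.
    have [d1 d10 hd1] := g4 (e / 2) ltac:(lra).
    have [d2 d20 hd2] := g3 (e / 2) ltac:(lra).
    exists (Num.min d1 d2); first by rewrite lt_min d10.
    move=> s; rewrite lt_min => /andP[/hd1 u1 /hd2 u2].
    set A := _^-1 in u1 *; set B := (r +i* t)^-1 in u1 *.
    set A' := _ * _ in u2 *; set B' := -1 * (- r +i* t)^-1 in u2 *.
    have -> : A + A' - (B + B') = (A - B) + (A' - B') by ring.
    by apply: le_lt_trans (normcD _ _) _; lra.
  congr path_continuous; apply/funext => t; rewrite !invE /v sqrrN; simpc.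
  rewrite /real_complex_def; congr (_ +i* _); last by ring.
  by rewrite [r ^+ 2 + t ^+ 2]addrC -mulrDl mulr_natl mulr2n.
have EH : cintegral (- r) r (fun t : R => (t +i* - r)^-1) -
    cintegral (- r) r (fun t : R => (t +i* r)^-1) =
    'i * cintegral (- r) r (fun t => (v t)%:C).
  rewrite -cintegralZ // -[X in _ - X]mul1r -mulNr -cintegralZ // -cintegralD //; last first.
    exact: path_continuousZ.
  apply: eq_cintegral => t _; rewrite !invE /v sqrrN; simpc.
  by congr (_ +i* _); field.
have EV : cintegral (- r) r (fun t : R => (r +i* t)^-1) -
    cintegral (- r) r (fun t : R => (- r +i* t)^-1) =
    cintegral (- r) r (fun t => (v t)%:C).
  rewrite -[X in _ - X]mul1r -mulNr -cintegralZ // -cintegralD //; last first.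
    exact: path_continuousZ.
  apply: eq_cintegral => t _; rewrite !invE /v sqrrN; simpc.
  rewrite /real_complex_def; congr (_ +i* _); last by ring.
  by rewrite [r ^+ 2 + t ^+ 2]addrC -mulrDl mulr_natl mulr2n.
rewrite /rect_integral EH EV -mulrDr Normc.normcM.
rewrite normc_i mul1r -mulr2n normcMn mulr2n.
suff : 2 <= N (cintegral (- r) r (fun t => (v t)%:C)) by lra.
apply: le_trans (Re_le_normc _); apply: le_trans (ler_norm _) => /=.
have -> : 2 = \int[@lebesgue_measure R]_(t in `[- r, r]) (cst (1 / r) t).
  by rewrite Rintegral_cst // fine_lebesgue_itv; [field|lra].
apply: le_Rintegral => //.
- exact: (path_integrable (@Re_dist R) (@path_continuous_cst R (- r) r (1 / r)%:C)).
- exact: (path_integrable (@Re_dist R) vc).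
- move=> t /=; rewrite in_itv /= => /andP[t1 t2].
  have tr : t ^+ 2 <= r ^+ 2 by rewrite -subr_ge0 subr_sqr mulr_ge0 //; lra.
  have pos : 0 < t ^+ 2 + r ^+ 2 by have := sqr_ge0 t; lra.
  by rewrite /v /= ler_pdivrMr // mulrAC ler_pdivlMr // mul1r -mulrA -expr2; lra.
Qed.

Lemma rect_integral_cst z a b c d : a <= b -> c <= d ->
  rect_integral (fun=> z) a b c d = 0.
Proof.
move=> ab cd; have -> : (fun=> z) = (fun w : R[i] => z + 0 * w).
  by apply/funext => w; rewrite mul0r addr0.
exact: rect_integral_affine.
Qed.

(** If f(z) = z0 + l / z + o(1 / |z|), the integral of f around a large square is
    close to l times that of 1 / z; by holomorphy it is the same for all squares
    around [- r, r] x [- r, r]. *)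
Lemma residue_infty_le f z0 l r : 0 < r ->
  (forall x y, ~~ (- r < x < r) || ~~ (- r < y < r) -> cdifferentiable f (x +i* y)) ->
  (forall e : R, 0 < e -> exists M : R, forall z, M < N z ->
     N (f z - z0 - l * z^-1) <= e / N z) ->
  4 * N l <= N (rect_integral f (- r) r (- r) r).
Proof.
move=> r0 fd finf; apply/ler_addgt0Pr => e e0.
have [M hM] := finf (e / 16) ltac:(lra).
pose s := Num.max r (`|M| + 1).
have rs : r <= s by rewrite le_max lexx.
have Ms : M < s by rewrite lt_max; apply/orP; right; have := ler_norm M; lra.
have s0 : 0 < s by lra.
have -> : rect_integral f (- r) r (- r) r = rect_integral f (- s) s (- s) s.
  by apply/esym; apply: rect_integral_shrink => [||||||x y _ _]; try lra; exact: fd.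
pose g z := f z - z0 - l * z^-1.
have nzh t u : `|u| = s -> t +i* u != 0.
  by move=> us; rewrite eq_complex /= negb_and -(normr_eq0 u) us (gt_eqF s0) orbT.
have nzv t u : `|u| = s -> u +i* t != 0.
  by move=> us; rewrite eq_complex /= negb_and -(normr_eq0 u) us (gt_eqF s0).
have ns : `|s| = s by rewrite ger0_norm // ltW.
have ns' : `|- s| = s by rewrite normrN.
have ic : boundary_cont (fun z : R[i] => z^-1) (- s) s (- s) s.
  by split=> t _; apply: continuous_pt_inv; first [by apply: nzh|by apply: nzv].
have rZ u v : boundary_cont v (- s) s (- s) s -> boundary_cont (fun z => u * v z) (- s) s (- s) s.
  by move=> [v1 v2 v3 v4]; split=> t ht; apply: continuous_ptZ;
   [exact: v1|exact: v2|exact: v3|exact: v4].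
have lic := rZ l _ ic.
have fc : boundary_cont f (- s) s (- s) s.
  by split=> t ht; apply: cdifferentiable_cont; apply: fd; lra.
have cc z : boundary_cont (fun=> z) (- s) s (- s) s.
  by split=> t ht; exact: continuous_pt_cst.
have gE : g = fun z => f z + (- z0 + (-1) * (l * z^-1)).
  by apply/funext => z; rewrite /g; ring.
have rD u v : boundary_cont u (- s) s (- s) s -> boundary_cont v (- s) s (- s) s ->
    boundary_cont (fun z => u z + v z) (- s) s (- s) s.
  by move=> [u1 u2 u3 u4] [v1 v2 v3 v4]; split=> t ht; apply: continuous_ptD;
   [exact: u1|exact: v1|exact: u2|exact: v2|exact: u3|exact: v3|exact: u4|exact: v4].
have nlic := rZ (-1) _ lic.
have gc : boundary_cont g (- s) s (- s) s by rewrite gE; apply: (rD) => //; exact: rD.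
have E : rect_integral g (- s) s (- s) s =
    rect_integral f (- s) s (- s) s - l * rect_integral (fun z => z^-1) (- s) s (- s) s.
  rewrite gE rect_integralD //; last exact: rD.
  rewrite rect_integralD // rect_integralZ // rect_integralZ //.
  have ss : - s <= s by lra.
  by rewrite (rect_integral_cst _ ss ss) add0r mulN1r.
have gle : N (rect_integral g (- s) s (- s) s) <= e.
  have H z : s <= N z -> N (g z) <= e / 16 / s.
    move=> sz; apply: le_trans (hM z _) _; first by lra.
    by rewrite ler_pM2l ?lef_pV2 ?posrE; lra.
  have := @rect_integral_le R g (- s) s (- s) s (e / 16 / s).
  have -> : 4 * (e / 16 / s) * (s - - s + (s - - s)) = e by field; rewrite gt_eqF.
  apply=> //; try lra.
  - by move=> x hx; split; apply: H; apply: le_trans (Im_le_normc _); rewrite /= ?ns' ?ns.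
  - by move=> x hx; split; apply: H; apply: le_trans (Re_le_normc _); rewrite /= ?ns' ?ns.
have h4 := rect_integral_inv s0.
have -> : rect_integral f (- s) s (- s) s =
    rect_integral g (- s) s (- s) s + l * rect_integral (fun z => z^-1) (- s) s (- s) s.
  by rewrite E subrK.
have h5 := normcB (rect_integral g (- s) s (- s) s +
  l * rect_integral (fun z => z^-1) (- s) s (- s) s) (rect_integral g (- s) s (- s) s).
rewrite addrC addKr Normc.normcM in h5.
have h6 : N l * 4 <= N l * N (rect_integral (fun z => z^-1) (- s) s (- s) s).
  by rewrite ler_wpM2l // normc_ge0.
rewrite addrC; lra.
Qed.

End RectCauchy.

(** * Integrals around nested squares *)

Section Tree.
Variable R : realType.
Implicit Types (r : R) (z w : R[i]) (f : R[i] -> R[i]).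
Local Open Scope complex_scope.

Lemma ReDZ z r w : Re (z + r%:C * w) = Re z + r * Re w.
Proof. by case: z w => [? ?] [? ?]; simpc. Qed.

Lemma ImDZ z r w : Im (z + r%:C * w) = Im z + r * Im w.
Proof. by case: z w => [? ?] [? ?]; simpc. Qed.

Definition offset (b : bool) : R := if b then 2 / 5 else - (2 / 5).

Definition centre (b : bool * bool) : R[i] := offset b.1 +i* offset b.2.

Definition square_integral f z r : R[i] :=
  rect_integral f (Re z - r) (Re z + r) (Im z - r) (Im z + r).

(** Holomorphy and the bound are only required on the closed square, so that the
    condition passes to the smaller squares around the pieces of A. *)
Definition holo_square_off f (A : set R[i]) z r :=
  forall x y, Re z - r <= x <= Re z + r -> Im z - r <= y <= Im z + r ->
  ~ (exists2 w, A w & x +i* y = z + r%:C * w) ->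
  cdifferentiable f (x +i* y) /\ N (f (x +i* y)) <= 1.

Lemma square_integral_le1 f (A : set R[i]) z r : 0 < r ->
  (forall w, A w -> `|Re w| < 1 /\ `|Im w| < 1) ->
  holo_square_off f A z r -> N (square_integral f z r) <= 16 * r.
Proof.
move=> r0 A1 fA.
have [ab cd] : Re z - r <= Re z + r /\ Im z - r <= Im z + r by split; lra.
have off x y : Re z - r <= x <= Re z + r -> Im z - r <= y <= Im z + r ->
    (x == Re z - r) || (x == Re z + r) || (y == Im z - r) || (y == Im z + r) ->
    cdifferentiable f (x +i* y) /\ N (f (x +i* y)) <= 1.
  move=> hx hy bd; apply: fA => // -[[w1 w2] Aw]; case: z {ab cd hx hy} bd => z1 z2 /=.
  simpc => /= bd [E1 E2]; have [] := A1 _ Aw; rewrite /= !ltr_norml => /andP[l1 l2] /andP[l3 l4].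
  have : - r < r * w1 < r by rewrite -{1}(mulr1 r) -mulrN ltr_pM2l // l1 -{2}(mulr1 r) ltr_pM2l.
  have : - r < r * w2 < r by rewrite -{1}(mulr1 r) -mulrN ltr_pM2l // l3 -{2}(mulr1 r) ltr_pM2l.
  move: bd; rewrite E1 E2; set u := r * w1; set v := r * w2 => bd hv hu.
  by case/orP: bd => [/orP[/orP[]|]|] /eqP; lra.
have -> : 16 * r = 4 * 1 * ((Re z + r - (Re z - r)) + (Im z + r - (Im z - r))) by ring.
apply: rect_integral_le => //.
- by split=> t ht; apply: cdifferentiable_cont;
    (apply: (off _ _ _ _ _).1; rewrite ?lexx ?ab ?cd ?eqxx ?orbT).
- by move=> t ht; split; (apply: (off _ _ _ _ _).2; rewrite ?lexx ?ab ?cd ?eqxx ?orbT).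
- by move=> t ht; split; (apply: (off _ _ _ _ _).2; rewrite ?lexx ?ab ?cd ?eqxx ?orbT).
Qed.

(** The sets centre b + q B cover A.  Each quadrant of the square contains exactly
    one of them (rescaled), inside a smaller square to which the integral around
    the quadrant shrinks. *)
Lemma square_integral_split f (A B : set R[i]) z r q : 0 < r -> 0 < q < 2 / 5 ->
  (forall w, B w -> `|Re w| < 1 /\ `|Im w| < 1) ->
  (forall w, A w -> exists b : bool * bool, exists2 w', B w' & w = centre b + q%:C * w') ->
  holo_square_off f A z r ->
  (forall b : bool * bool, holo_square_off f B (z + r%:C * centre b) (r * q)) /\
  square_integral f z r =
    \sum_(b : bool * bool) square_integral f (z + r%:C * centre b) (r * q).
Proof.
move=> r0 /andP[q0 q5] B1 AB fA.
have rq0 : 0 < r * q by rewrite mulr_gt0.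
have rq5 : r * q < 2 / 5 * r by rewrite mulrC ltr_pM2r.
have ReE (b : bool * bool) : Re (z + r%:C * centre b) = Re z + r * offset b.1.
  exact: ReDZ.
have ImE (b : bool * bool) : Im (z + r%:C * centre b) = Im z + r * offset b.2.
  exact: ImDZ.
have offE (b : bool) : (r * offset b = 2 / 5 * r) \/ (r * offset b = - (2 / 5 * r)).
  by case: b; rewrite /offset; [left|right]; ring.
(* the omitted points lie in the open squares around the four pieces *)
have hole x y : (exists2 w, A w & x +i* y = z + r%:C * w) ->
    exists b : bool * bool,
    [/\ `|x - (Re z + r * offset b.1)| < r * q,
        `|y - (Im z + r * offset b.2)| < r * q &
     exists2 w, B w & x +i* y = z + r%:C * centre b + (r * q)%:C * w].
  move=> [w Aw E]; have [b [w' Bw' wE]] := AB w Aw; exists b.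
  have E2 : x +i* y = z + r%:C * centre b + (r * q)%:C * w'.
    by rewrite E wE rmorphM; ring.
  split; last by exists w'.
  - have [h _] := B1 _ Bw'.
    have -> : x = Re z + r * offset b.1 + r * q * Re w'.
      by have := congr1 (@complex.Re R) E2; rewrite !ReDZ.
    by rewrite addrC addKr normrM (gtr0_norm rq0) -{2}(mulr1 (r * q)) ltr_pM2l.
  - have [_ h] := B1 _ Bw'.
    have -> : y = Im z + r * offset b.2 + r * q * Im w'.
      by have := congr1 (@complex.Im R) E2; rewrite !ImDZ.
    by rewrite addrC addKr normrM (gtr0_norm rq0) -{2}(mulr1 (r * q)) ltr_pM2l.
(* these squares are pairwise disjoint *)
have sepb (b b' : bool) (u v : R) : `|u - (v + r * offset b)| <= r * q ->
    `|u - (v + r * offset b')| < r * q -> b' = b.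
  rewrite ler_norml ltr_norml => /andP[h1 h2] /andP[h3 h4].
  by move: h1 h2 h3 h4; case: b; case: b'; rewrite /offset => // h1 h2 h3 h4; exfalso; lra.
split=> [b x y|].
  rewrite ReE ImE => hx hy hB; apply: fA.
  - by case: (offE b.1) => E; rewrite E in hx; lra.
  - by case: (offE b.2) => E; rewrite E in hy; lra.
  - move=> /hole[b' [h1 h2 h3]]; apply: hB.
    suff <- : b' = b by [].
    case: b b' hx hy h1 h2 h3 => [b1 b2] [b1' b2'] /= hx hy h1 h2 _.
    by congr (_, _); [apply: (sepb _ _ x (Re z))|apply: (sepb _ _ y (Im z))];
      rewrite // ler_norml; lra.
have fd x y : Re z - r <= x <= Re z + r -> Im z - r <= y <= Im z + r ->
    (forall b : bool * bool, ~~ (`|x - (Re z + r * offset b.1)| < r * q) ||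
       ~~ (`|y - (Im z + r * offset b.2)| < r * q)) ->
    cdifferentiable f (x +i* y).
  move=> hx hy nh; apply: (fA x y hx hy _).1 => /hole[b [h1 h2 _]].
  by move: (nh b); rewrite h1 h2.
have fc x y : Re z - r <= x <= Re z + r -> Im z - r <= y <= Im z + r ->
    [|| x == Re z - r, x == Re z, x == Re z + r, y == Im z - r, y == Im z | y == Im z + r] ->
    continuous_pt f (x +i* y).
  move=> hx hy hxy; apply: cdifferentiable_cont; apply: fd => // b.
  have far (v : R) (b' : bool) : [|| v == - r, v == 0 | v == r] ->
      r * q <= `|v - r * offset b'|.
    rewrite ler_normr => hv; apply/orP.
    by case: (offE b') => ->; case/or3P: hv => /eqP ->; first [left; lra|right; lra].
  rewrite -!leNgt !opprD !addrA.
  case/or4P: hxy => [/eqP->|/eqP->|/eqP->|/or3P[]/eqP->]; apply/orP;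
    first [left; apply: far; apply/or3P;
    by first [by apply: Or31; apply/eqP; ring|by apply: Or32; apply/eqP; ring|
              by apply: Or33; apply/eqP; ring]
   |right; apply: far; apply/or3P;
    by first [by apply: Or31; apply/eqP; ring|by apply: Or32; apply/eqP; ring|
              by apply: Or33; apply/eqP; ring]].
have sumE (F : bool * bool -> R[i]) : \sum_(b : bool * bool) F b =
    F (true, true) + F (true, false) + (F (false, true) + F (false, false)).
  rewrite (eq_bigr (fun b : bool * bool => F (b.1, b.2))) => [|[? ?] _ //].
  by rewrite -(pair_bigA _ (fun b1 b2 : bool => F (b1, b2))) /= !big_bool.
have quad (b1 b2 : bool) u1 u2 v1 v2 :
    u1 = (if b1 then Re z else Re z - r) -> u2 = (if b1 then Re z + r else Re z) ->
    v1 = (if b2 then Im z else Im z - r) -> v2 = (if b2 then Im z + r else Im z) ->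
    rect_integral f u1 u2 v1 v2 = square_integral f (z + r%:C * centre (b1, b2)) (r * q).
  move=> u1E u2E v1E v2E; rewrite /square_integral ReE ImE /=.
  apply: rect_integral_shrink; try by rewrite ?u1E ?u2E ?v1E ?v2E /offset; case: (b1); case: (b2); lra.
  move=> x y hx hy hxy; apply: fd.
  - by move: hx; rewrite u1E u2E; case: (b1); lra.
  - by move: hy; rewrite v1E v2E; case: (b2); lra.
  - move=> [b1' b2'] /=; rewrite !ltr_norml.
    move: hx hy hxy; rewrite u1E u2E v1E v2E /offset.
    by case: b1 {u1E u2E}; case: b2 {v1E v2E}; case: b1'; case: b2' => hx hy hxy; lra.
rewrite sumE -(quad true true _ _ _ _ erefl erefl erefl erefl).
rewrite -(quad true false _ _ _ _ erefl erefl erefl erefl).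
rewrite -(quad false true _ _ _ _ erefl erefl erefl erefl).
rewrite -(quad false false _ _ _ _ erefl erefl erefl erefl).
have [x1 x2 y1 y2] : [/\ Re z - r <= Re z, Re z <= Re z + r, Im z - r <= Im z & Im z <= Im z + r].
  by split; lra.
rewrite /square_integral.
rewrite (@rect_integral_splitx _ f _ (Re z)) //; last 2 first.
- by move=> t ht; apply: fc; rewrite ?eqxx ?orbT //; lra.
- by move=> t ht; apply: fc; rewrite ?eqxx ?orbT //; lra.
rewrite (@rect_integral_splity _ f (Re z - r) _ _ (Im z)) //; last 2 first.
- by move=> t ht; apply: fc; rewrite ?eqxx ?orbT //; lra.
- by move=> t ht; apply: fc; rewrite ?eqxx ?orbT //; lra.
rewrite (@rect_integral_splity _ f (Re z) _ _ (Im z)) //; last 2 first.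
- by move=> t ht; apply: fc; rewrite ?eqxx ?orbT //; lra.
- by move=> t ht; apply: fc; rewrite ?eqxx ?orbT //; lra.
by ring.
Qed.

(** After d splittings there are 4^d squares of half-side r times the product of
    the q k, around each of which the integral is at most 16 times the
    half-side. *)
Lemma square_integral_tree f (A : nat -> set R[i]) (q : nat -> R) :
  (forall n, 0 < q n < 2 / 5) ->
  (forall n w, A n w -> `|Re w| < 1 /\ `|Im w| < 1) ->
  (forall n w, A n w -> exists b : bool * bool, exists2 w', A n.+1 w' &
     w = centre b + (q n)%:C * w') ->
  forall d n z r, 0 < r -> holo_square_off f (A n) z r ->
  N (square_integral f z r) <= 16 * r * \prod_(n <= k < n + d) (4 * q k).
Proof.
move=> q05 A1 AA; elim=> [|d IH] n z r r0 fA.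
  by rewrite addn0 big_geq // mulr1; exact: square_integral_le1 (A1 n) fA.
have [fB ->] := square_integral_split r0 (q05 n) (A1 n.+1) (AA n) fA.
have /andP[q0 _] := q05 n.
apply: le_trans (normc_sum _ _ _) _.
rewrite big_ltn ?addnS ?ltnS ?leq_addr // -addSn.
set P := \prod_(_ <= _ < _) _.
have -> : 16 * r * (4 * q n * P) = \sum_(b : bool * bool) (16 * (r * q n) * P).
  by rewrite sumr_const card_prod card_bool -mulr_natl; ring.
by apply: ler_sum => b _; apply: IH (fB b); rewrite mulr_gt0.
Qed.

End Tree.

Arguments offset {R} b.
Arguments centre {R} b.

(** * Limits of sequences and of differentiable functions *)

Section Limits.
Variable R : realType.
Implicit Types (r e : R) (z w : R[i]) (f : R[i] -> R[i]).
Local Open Scope complex_scope.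

Definition clim (u : nat -> R[i]) l :=
  forall e : R, 0 < e -> exists n0, forall n, (n0 <= n)%N -> N (u n - l) <= e.

Lemma real_cauchy_cvg (v : nat -> R) :
  (forall e : R, 0 < e -> exists n0, forall m n, (n0 <= m)%N -> (n0 <= n)%N -> `|v m - v n| <= e) ->
  exists l, forall e : R, 0 < e -> exists n0, forall n, (n0 <= n)%N -> `|v n - l| <= e.
Proof.
move=> vC.
have /cvg_ex[l /cvgrPdist_le vl] : cvgn v.
  apply/cauchy_cvgP/cauchy_exP => e e0; have [n0 hn0] := vC (e / 2) ltac:(lra).
  exists (v n0); exists n0 => // n /= n0n; rewrite /ball /=.
  by apply: le_lt_trans (hn0 _ _ (leqnn _) n0n) _; lra.
exists l => e /vl[n0 _ hn0]; exists n0 => n n0n; rewrite distrC; exact: hn0.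
Qed.

Lemma ccauchy_clim (u : nat -> R[i]) :
  (forall e : R, 0 < e -> exists n0, forall m n, (n0 <= m)%N -> (n0 <= n)%N -> N (u m - u n) <= e) ->
  exists l, clim u l.
Proof.
move=> uC.
have real (p : R[i] -> R) : (forall x y, `|p x - p y| <= N (x - y)) ->
    exists l, forall e : R, 0 < e -> exists n0, forall n, (n0 <= n)%N -> `|p (u n) - l| <= e.
  move=> pl; apply: real_cauchy_cvg => e /uC[n0 h]; exists n0 => m n hm hn.
  by apply: le_trans (pl _ _) _; exact: h.
have [a ha] := real _ (@Re_dist R); have [b hb] := real _ (@Im_dist R).
exists (a +i* b) => e e0.
have [n1 h1] := ha (e / 2) ltac:(lra); have [n2 h2] := hb (e / 2) ltac:(lra).
exists (maxn n1 n2) => n; rewrite geq_max => /andP[/h1 g1 /h2 g2].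
apply: le_trans (normc_le_ReIm _) _.
by move: g1 g2; case: (u n) => x y; simpc => /=; lra.
Qed.

Lemma clim_le u l z M n0 : clim u l -> (forall n, (n0 <= n)%N -> N (u n - z) <= M) ->
  N (l - z) <= M.
Proof.
move=> ul uM; apply/ler_addgt0Pr => e /ul[n1 h1].
have := h1 _ (leq_maxr n0 n1); have := uM _ (leq_maxl n0 n1).
set n := maxn _ _ => g1 g2.
have := normc_dist_le l (u n) z; rewrite [N (l - u n)]normcBC; lra.
Qed.

Lemma clim_unique u l l' : clim u l -> clim u l' -> l = l'.
Proof.
move=> ul ul'; apply/eqP; rewrite -subr_eq0 -normc_eq0 eq_le normc_ge0 andbT.
apply/ler_addgt0Pr => e /ul'[n0 h]; rewrite add0r; exact: clim_le ul h.
Qed.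

Lemma clim_cst z : clim (fun=> z) z.
Proof. by move=> e e0; exists 0%N => n _; rewrite subrr Normc.normc0 ltW. Qed.

Lemma eq_clim u v l n0 : (forall n, (n0 <= n)%N -> u n = v n) -> clim u l -> clim v l.
Proof.
move=> uv ul e /ul[n1 h]; exists (maxn n0 n1) => n; rewrite geq_max => /andP[h0 h1].
by rewrite -uv //; exact: h.
Qed.

Lemma clim_affine u l z w : clim u l -> clim (fun n => z + w * u n) (z + w * l).
Proof.
move=> ul e e0; have w1 : 0 < 1 + N w by rewrite ltr_wpDr ?normc_ge0.
have [n0 h] := ul (e / (1 + N w)) (divr_gt0 e0 w1); exists n0 => n /h.
rewrite ler_pdivlMr // => g.
have -> : z + w * u n - (z + w * l) = w * (u n - l) by ring.
rewrite Normc.normcM; apply: le_trans g.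
by rewrite mulrC ler_wpM2l ?normc_ge0 // lerDr.
Qed.

(** A quadratic bound on the Taylor remainder at z, on the disc of radius d.
    Unlike differentiability alone, it passes to limits when d and M are
    uniform. *)
Definition second_order_at f z (d M : R) := exists l, forall h, N h <= d ->
  N (f (z + h) - f z - h * l) <= M * N h ^+ 2.

Lemma second_order_cdifferentiable f z d M : 0 < d ->
  second_order_at f z d M -> cdifferentiable f z.
Proof.
move=> d0 [l hl]; exists l => e e0.
have M1 : 0 < 1 + `|M| by rewrite ltr_wpDr.
exists (Num.min d (e / (1 + `|M|))); first by rewrite lt_min d0 divr_gt0.
move=> h; rewrite lt_min => /andP[/ltW /hl h1]; rewrite ltr_pdivlMr // => h2.
apply: le_trans h1 _; rewrite expr2 mulrA ler_wpM2r ?normc_ge0 //.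
apply: le_trans (ltW h2); rewrite mulrDr mulr1.
have := ler_norm M; have := normc_ge0 h => h3 h4.
by apply: le_trans (ler_wpM2r h3 h4) _; rewrite mulrC lerDr.
Qed.

(** The derivatives at z form a Cauchy sequence: they differ from the difference
    quotients with a fixed small increment h by at most M |h|, and these
    quotients converge. *)
Lemma second_order_lim (g : nat -> R[i] -> R[i]) f z (d M : R) n0 : 0 < d -> 0 <= M ->
  (forall h, N h <= d -> clim (fun n => g n (z + h)) (f (z + h))) ->
  (forall n, (n0 <= n)%N -> second_order_at (g n) z d M) ->
  second_order_at f z d M.
Proof.
move=> d0 M0 gf /(_ _ _)/cid gl0.
pose l n := if pselect (n0 <= n)%N is left H then sval (gl0 n H) else 0.
have hl n : (n0 <= n)%N -> forall h, N h <= d ->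
    N (g n (z + h) - g n z - h * l n) <= M * N h ^+ 2.
  by rewrite /l; case: pselect => // H _; case: (gl0 n H).
have g0 : clim (fun n => g n z) (f z).
  by have := gf 0; rewrite Normc.normc0 addr0; apply; exact: ltW.
have [L lL] : exists L, clim l L.
  apply: ccauchy_clim => e e0.
  have M1 : 0 < 4 * (1 + M) by lra.
(* an increment for which both remainders, divided by h, are below e / 4 *)
  pose h : R := Num.min d (e / (4 * (1 + M))).
  have h0 : 0 < h by rewrite lt_min d0 divr_gt0.
  have hd : h <= d by rewrite ge_min lexx.
  have hM : h * (4 * (1 + M)) <= e by rewrite -ler_pdivlMr // ge_min lexx orbT.
  have nh : N h%:C = h by rewrite normc_real gtr0_norm.
  have eh : 0 < e * h / 8 by rewrite divr_gt0 // mulr_gt0.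
  have [n1 h1] := gf h%:C ltac:(rewrite nh; exact: hd) _ eh.
  have [n2 h2] := g0 _ eh.
  exists (maxn n0 (maxn n1 n2)) => m n; rewrite !geq_max => /and3P[m0 m1 m2] /and3P[p0 p1 p2].
  have A1 := hl m m0 h%:C; have A2 := hl n p0 h%:C; rewrite nh in A1 A2.
  have {}A1 := A1 hd; have {}A2 := A2 hd.
  have B1 := h1 m m1; have B2 := h1 n p1; have B3 := h2 m m2; have B4 := h2 n p2.
  have E : N (h%:C * (l m - l n)) = h * N (l m - l n) by rewrite Normc.normcM nh.
  rewrite -(ler_pM2l h0) -E.
  set f1 := f _ in B1 B2; set f0 := f z in B3 B4.
  set a1 := g m _ in A1 B1; set a0 := g m z in A1 B3.
  set b1 := g n _ in A2 B2; set b0 := g n z in A2 B4.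
  have -> : h%:C * (l m - l n) = (b1 - b0 - h%:C * l n) - (a1 - a0 - h%:C * l m)
     + ((a1 - f1) - (b1 - f1)) - ((a0 - f0) - (b0 - f0)) by ring.
  have C1 := normcB (b1 - b0 - h%:C * l n) (a1 - a0 - h%:C * l m).
  have C2 := normcB (a1 - f1) (b1 - f1).
  have C3 := normcB (a0 - f0) (b0 - f0).
  have C4 := normcD (b1 - b0 - h%:C * l n - (a1 - a0 - h%:C * l m)) (a1 - f1 - (b1 - f1)).
  have C5 := normcB (b1 - b0 - h%:C * l n - (a1 - a0 - h%:C * l m) + (a1 - f1 - (b1 - f1)))
    (a0 - f0 - (b0 - f0)).
  have F : M * h ^+ 2 <= e * h / 4.
    have -> : M * h ^+ 2 = h * (h * M) by ring.
    have -> : e * h / 4 = h * (e / 4) by ring.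
    by rewrite ler_pM2l //; lra.
  lra.
exists L => h hd.
have : clim (fun n => g n (z + h) - g n z - h * l n) (f (z + h) - f z - h * L).
  move=> e e0; have e3 : 0 < e / 3 by lra.
  have h1' : 0 < 1 + N h by rewrite ltr_wpDr ?normc_ge0.
  have [n1 h1] := gf h hd _ e3; have [n2 h2] := g0 _ e3.
  have [n3 h3] := lL _ (divr_gt0 e3 h1').
  exists (maxn n1 (maxn n2 n3)) => n; rewrite !geq_max => /and3P[/h1 k1 /h2 k2 /h3 k3].
  rewrite ler_pdivlMr // in k3.
  have -> : g n (z + h) - g n z - h * l n - (f (z + h) - f z - h * L) =
    ((g n (z + h) - f (z + h)) - (g n z - f z)) - h * (l n - L) by ring.
  have C1 := normcB (g n (z + h) - f (z + h)) (g n z - f z).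
  have C2 := normcB (g n (z + h) - f (z + h) - (g n z - f z)) (h * (l n - L)).
  rewrite Normc.normcM in C2.
  have C3 : N h * N (l n - L) <= N (l n - L) * (1 + N h).
    by rewrite mulrDr mulr1 [N h * _]mulrC lerDr normc_ge0.
  lra.
move=> /(@clim_le _ _ 0 (M * N h ^+ 2) n0); rewrite subr0; apply => n n0n.
by rewrite subr0; exact: hl.
Qed.

End Limits.

(** * The Cantor set *)

Section CantorSet.
Variable R : realType.
Implicit Types (r e : R) (z w : R[i]) (b : bool * bool).
Local Open Scope complex_scope.

(** The values make 4^n times the product of the first n ratios equal to
    ((n + 15) / 15)^2: it grows, with a summable inverse, yet slower than any
    geometric sequence.  The shift by 15 keeps every ratio below 2 / 7. *)
Definition ratio (n : nat) : R := (n%:R + 16) ^+ 2 / (4 * (n%:R + 15) ^+ 2).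

Lemma ratio_gt n : 1 / 4 < ratio n.
Proof.
rewrite /ratio; have n0 : 0 <= n%:R :> R by [].
have p : 0 < (n%:R + 15 : R) ^+ 2 by rewrite exprn_gt0 //; lra.
rewrite ltr_pdivlMr ?mulr_gt0 //; set x : R := n%:R in n0 *.
by rewrite !expr2; lra.
Qed.

Lemma ratio_le n : ratio n <= 2 / 7.
Proof.
rewrite /ratio; have n0 : 0 <= n%:R :> R by [].
have p : 0 < (n%:R + 15 : R) ^+ 2 by rewrite exprn_gt0 //; lra.
rewrite ler_pdivrMr ?mulr_gt0 //; set x : R := n%:R in n0 *.
have : 0 <= x * x by rewrite mulr_ge0.
by rewrite !expr2; lra.
Qed.

Lemma ratio_gt0 n : 0 < ratio n. Proof. by have := ratio_gt n; lra. Qed.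

Definition quadrant z : bool * bool := (0 <= Re z, 0 <= Im z).

Lemma centre_le b : N (centre b : R[i]) <= 4 / 7.
Proof.
have h : 0 <= 4 / 7 :> R by lra.
rewrite -(@ler_pXn2r _ 2) ?nnegrE ?normc_ge0 //.
by rewrite normc_sqr; case: b => [[] []]; rewrite /= /offset !expr2; lra.
Qed.

Lemma other_centre_far z b : b != quadrant z -> 2 / 5 <= N (z - centre b).
Proof.
have far (x : R) (c : bool) : c != (0 <= x) -> 2 / 5 <= `|x - offset c|.
  by rewrite ler_normr /offset; case: leP; case: c => // hx _; apply/orP;
    first [left; lra|right; lra].
case: z b => x y [b1 b2]; rewrite xpair_eqE negb_and => /orP[] /far h.
  exact: le_trans h (Re_dist (x +i* y) (centre (b1, b2))).
exact: le_trans h (Im_dist (x +i* y) (centre (b1, b2))).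
Qed.

Lemma near_centre z b : N (z - centre b) < 2 / 5 -> b = quadrant z.
Proof. by move=> h; apply/eqP; apply: contraLR h => /other_centre_far; rewrite leNgt. Qed.

Definition chart n b z : R[i] := (z - centre b) / (ratio n)%:C.

Lemma ratioC_neq0 n : (ratio n)%:C != 0 :> R[i].
Proof. by rewrite -normc_eq0 normc_real normr_eq0 gt_eqF ?ratio_gt0. Qed.

Lemma normc_chart n b z : N (chart n b z) = N (z - centre b) / ratio n.
Proof. by rewrite Normc.normcM Normc.normcV normc_real gtr0_norm ?ratio_gt0. Qed.

Lemma chartK n b z : centre b + (ratio n)%:C * chart n b z = z.
Proof. by rewrite /chart mulrC divfK ?ratioC_neq0 // subrKC. Qed.

Lemma chart_inv n b w : chart n b (centre b + (ratio n)%:C * w) = w.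
Proof. by rewrite /chart addrAC subrr add0r mulrAC mulfV ?mul1r ?ratioC_neq0. Qed.

Lemma chartB n b z w : chart n b z - chart n b w = (z - w) / (ratio n)%:C.
Proof. by rewrite /chart; field; exact: ratioC_neq0. Qed.

(** Union of the discs obtained after d steps when the construction starts at
    level n, in the coordinates of the unit disc. *)
Fixpoint generation n d z : Prop :=
  if d is d'.+1 then exists b, generation n.+1 d' (chart n b z) else N z <= 1.

Definition cantor n z := forall d, generation n d z.

Lemma inner_of_chart n b z : N (chart n b z) <= 1 -> N (z - centre b) <= ratio n.
Proof. by rewrite normc_chart ler_pdivrMr ?ratio_gt0 // mul1r. Qed.

Lemma generationS n d z : generation n d.+1 z -> generation n d z.
Proof.
elim: d n z => [|d IH] n z /= [b h]; last by exists b; exact: IH.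
have := inner_of_chart h; have := ratio_le n; have := centre_le b.
have := normcD (z - centre b) (centre b); rewrite subrK; lra.
Qed.

Lemma generation_mono n d d' z : (d <= d')%N -> generation n d' z -> generation n d z.
Proof. by move=> /subnK <-; elim: (d' - d)%N => // k IH /generationS. Qed.

(** Discs around different centres are separated by the coordinate axes, so the
    quadrant of a point determines the only disc that may contain it. *)
Lemma generation_quadrant n d z b : generation n.+1 d (chart n b z) -> b = quadrant z.
Proof.
move=> /(generation_mono (leq0n _)) /= /inner_of_chart h; apply: near_centre.
by have := ratio_le n; lra.
Qed.

Lemma cantor_chart n z : cantor n z -> exists2 w, cantor n.+1 w &
  z = centre (quadrant z) + (ratio n)%:C * w.
Proof.
move=> h; exists (chart n (quadrant z) z); last by rewrite chartK.
by move=> d; have [b hb] := h d.+1; rewrite -(generation_quadrant hb).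
Qed.

Lemma cantor_norm n z : cantor n z -> N z <= 6 / 7.
Proof.
move=> h; have [b /inner_of_chart hb] := h 1%N.
have := ratio_le n; have := centre_le b.
have := normcD (z - centre b) (centre b); rewrite subrK; lra.
Qed.

Definition away n d z e := forall u, generation n d u -> e <= N (z - u).

(** Each generation is a finite union of closed discs; the distance is found by
    recursion on the generation, from the four charts. *)
Lemma not_generation_away n d z : ~ generation n d z -> exists2 e : R, 0 < e & away n d z e.
Proof.
elim: d n z => [|d IH] n z /= hz.
  exists (N z - 1); first by move/negP: hz; rewrite -ltNge; lra.
  by move=> u /= u1; have := normc_sub_ge z u; lra.
have H b : exists2 e : R, 0 < e & away n.+1 d (chart n b z) e.
  by apply: IH => h; apply: hz; exists b.
have [e1 p1 h1] := H (true, true); have [e2 p2 h2] := H (true, false).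
have [e3 p3 h3] := H (false, true); have [e4 p4 h4] := H (false, false).
pose e := Num.min (Num.min e1 e2) (Num.min e3 e4).
exists (ratio n * e); first by rewrite mulr_gt0 ?ratio_gt0 // /e !lt_min p1 p2 p3 p4.
move=> u [b hb].
suff : e <= N (chart n b z - chart n b u).
  rewrite chartB Normc.normcM Normc.normcV normc_real gtr0_norm ?ratio_gt0 //.
  by rewrite ler_pdivlMr ?ratio_gt0 // mulrC.
by move: b hb => [[] []] hb; [apply: le_trans (h1 _ hb)|apply: le_trans (h2 _ hb)|
  apply: le_trans (h3 _ hb)|apply: le_trans (h4 _ hb)]; rewrite /e !ge_min lexx ?orbT.
Qed.

Lemma not_cantor_away n z : ~ cantor n z ->
  exists2 e : R, 0 < e & exists d0, forall d, (d0 <= d)%N -> away n d z e.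
Proof.
move=> /existsNP[d0 /not_generation_away[e e0 h]]; exists e => //; exists d0 => d dd u hu.
by apply: h; exact: generation_mono hu.
Qed.

Lemma cantor_closed n : closed (cantor n : set (cplx R)).
Proof.
move=> z hz; apply: contrapT => /not_cantor_away[e e0 [d0 h]].
have [w [cw]] := hz _ (nbhs_disc z e0).
rewrite /= normcBC => h1; have := h d0 (leqnn _) w (cw d0); lra.
Qed.

Lemma cantor_compact n : compact (cantor n : set (cplx R)).
Proof.
apply: (closed_bounded_compact (r := 6 / 7) (@cantor_closed n)).
by move=> z /cantor_norm.
Qed.

Lemma ratio_prod n : \prod_(0 <= k < n) (4 * ratio k) = ((n%:R + 15) / 15) ^+ 2.
Proof.
elim: n => [|n IH]; first by rewrite big_geq // add0r divff ?expr1n // pnatr_eq0.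
rewrite big_nat_recr //= IH /ratio -natr1.
have n0 : 0 <= n%:R :> R by [].
by field; rewrite gt_eqF //; lra.
Qed.

End CantorSet.

Arguments ratio {R} n.

(** * The Cauchy transform of the Cantor set *)

Section Potential.
Variable R : realType.
Implicit Types (r e : R) (z w : R[i]) (b : bool * bool).
Local Open Scope complex_scope.

(** Cauchy transform of the uniform probability measure on the unit disc.  It is
    bounded and continuous, unlike that of a point mass. *)
Definition kernel z : R[i] := if 1 <= N z then z^-1 else z^*.

Lemma kernel_le1 z : N (kernel z) <= 1.
Proof.
rewrite /kernel; case: (leP 1 (N z)) => h; last by rewrite normc_conj ltW.
by rewrite Normc.normcV invf_le1 // (lt_le_trans ltr01).
Qed.

Lemma kernel_lipschitz z w : N (kernel z - kernel w) <= 3 * N (z - w).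
Proof.
have conjB (x y : R[i]) : N (x^* - y^* : R[i]) = N (x - y) by rewrite -normc_conj rmorphB /= !conjcK.
have nz (x : R[i]) : 1 <= N x -> x != 0 by move=> h; rewrite -normc_gt0; lra.
have mixed (x y : R[i]) : N x < 1 -> 1 <= N y -> N (x^* - y^-1) <= 3 * N (x - y).
  move=> x1 y1.
  have -> : x^* - y^-1 = (x^* - y^*) + (y^* - y^-1) by ring.
  apply: le_trans (normcD _ _) _; rewrite conjB.
  suff : N (y^* - y^-1) <= 2 * N (x - y) by lra.
  have yn := nz y y1.
  have -> : y^* - y^-1 = ((N y ^+ 2 - 1)%:C) / y.
    have -> : (N y ^+ 2 - 1)%:C = y * y^* - 1.
      by rewrite normc_sqr; case: (y) => a b; simpc; congr (_ +i* _); ring.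
    rewrite mulrBl mul1r; congr (_ - _).
    by rewrite mulrAC mulfV ?mul1r.
  rewrite Normc.normcM Normc.normcV normc_real ger0_norm; last by rewrite subr_ge0 exprn_ege1.
  rewrite ler_pdivrMr ?normc_gt0 //.
  have h := normc_sub_ge y x; rewrite normcBC in h.
  have -> : N y ^+ 2 - 1 = (N y - 1) * (N y + 1) by ring.
  set s := N y in y1 h *; set t := N (x - y) in h *; have ts : s - 1 <= t by lra.
  have : (s - 1) * (s + 1) <= t * (s + 1) by rewrite ler_wpM2r //; lra.
  have : t * (s + 1) <= t * (2 * s) by rewrite ler_wpM2l //; lra.
  lra.
have n3 : N (z - w) <= 3 * N (z - w) by have := normc_ge0 (z - w); lra.
rewrite /kernel; case: (leP 1 (N z)) => hz; case: (leP 1 (N w)) => hw.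
- have -> : z^-1 - w^-1 = (w - z) / (z * w) by field; rewrite !nz.
  rewrite Normc.normcM Normc.normcV Normc.normcM normcBC.
  apply: le_trans n3; rewrite ler_piMr ?normc_ge0 // invf_le1 ?mulr_gt0 ?normc_gt0 ?nz //.
  by rewrite mulr_ege1.
- by rewrite normcBC [N (z - w)]normcBC; exact: mixed.
- exact: mixed.
- by rewrite conjB.
Qed.

(** Each of the four children carries a quarter of the mass, and the chart
    rescales the transform by 1 / ratio n. *)
Definition weight n : R := (4 * ratio n)^-1.

Lemma weight_gt0 n : 0 < weight n.
Proof. by rewrite invr_gt0 mulr_gt0 // ratio_gt0. Qed.

Lemma weight_lt1 n : weight n < 1.
Proof. by rewrite invf_lt1 ?mulr_gt0 ?ratio_gt0 //; have := @ratio_gt R n; lra. Qed.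

Lemma weight_ratio n : weight n * ratio n = 1 / 4.
Proof. by rewrite /weight; field; rewrite gt_eqF ?ratio_gt0. Qed.

(** Cauchy transform of the probability measure equidistributed on the discs of
    generation d. *)
Fixpoint potential n d z : R[i] :=
  if d is d'.+1 then \sum_b (weight n)%:C * potential n.+1 d' (chart n b z)
  else kernel z.

Lemma sum_centres_le (F : bool * bool -> R) M : (forall b, F b <= M) -> \sum_b F b <= 4 * M.
Proof.
move=> h; apply: le_trans (ler_sum _ (fun b _ => h b)) _.
by rewrite sumr_const card_prod card_bool mulr_natl.
Qed.

Lemma normc_wsum n (F : bool * bool -> R[i]) :
  N (\sum_b (weight n)%:C * F b) <= \sum_b weight n * N (F b).
Proof.
apply: le_trans (normc_sum _ _ _) _; apply: ler_sum => b _.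
by rewrite Normc.normcM normc_real gtr0_norm ?weight_gt0.
Qed.

Lemma potential_lipschitz n d : exists2 L : R, 0 <= L &
  forall z w, N (potential n d z - potential n d w) <= L * N (z - w).
Proof.
elim: d n => [|d IH] n; first by exists 3 => //; exact: kernel_lipschitz.
have [L L0 hL] := IH n.+1; exists (4 * (L / ratio n)).
  by rewrite mulr_ge0 // divr_ge0 // ltW // ratio_gt0.
move=> z w /=; rewrite -sumrB.
under eq_bigr do rewrite -mulrBr.
apply: le_trans (normc_wsum _ _) _; rewrite -mulrA; apply: sum_centres_le => b.
apply: le_trans (_ : _ <= 1 * (L * N (chart n b z - chart n b w))) _.
  apply: ler_pM; rewrite ?normc_ge0 ?(ltW (weight_gt0 _)) ?(ltW (weight_lt1 _)) //.
rewrite mul1r chartB Normc.normcM Normc.normcV normc_real gtr0_norm ?ratio_gt0 //.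
by rewrite mulrCA mulrC.
Qed.

Lemma far_centre z b : 7 / 5 <= N z -> 29 / 49 * N z <= N (z - centre b).
Proof. by move=> h; have := normc_sub_ge z (centre b); have := @centre_le R b; lra. Qed.

Lemma chart_far n z b : 7 / 5 <= N z -> 7 / 5 <= N (chart n b z).
Proof.
move=> h; rewrite normc_chart ler_pdivlMr ?ratio_gt0 //.
by have := far_centre b h; have := @ratio_le R n; lra.
Qed.

Lemma chart_other_far n z b : b != quadrant z -> 7 / 5 <= N (chart n b z).
Proof.
move=> /other_centre_far h; rewrite normc_chart ler_pdivlMr ?ratio_gt0 //.
by have := @ratio_le R n; lra.
Qed.

(** The contraction behind the geometric decay of increments far from the set:
    (2 / 7) (49 / 29)^2 < 5 / 6, where |z - c| >= (29 / 49) |z| for |z| >= 7 / 5. *)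
Lemma ratio_far_sqr n z b : 7 / 5 <= N z ->
  (ratio n / N (z - centre b)) ^+ 2 <= ratio n * (5 / 6) / N z ^+ 2.
Proof.
move=> h; have fz := far_centre b h; have r0 := @ratio_gt0 R n.
have z0 : 0 < N z by lra.
have c0 : 0 < N (z - centre b) by lra.
rewrite expr_div_n ler_pdivrMr ?exprn_gt0 // mulrAC ler_pdivlMr ?exprn_gt0 //.
rewrite expr2 -mulrA -[leRHS]mulrA ler_pM2l //.
apply: le_trans (_ : _ <= 2 / 7 * N z ^+ 2) _.
  by rewrite ler_wpM2r ?sqr_ge0 // ratio_le.
have h2 : (29 / 49 * N z) ^+ 2 <= N (z - centre b) ^+ 2.
  by rewrite ler_pXn2r // nnegrE; lra.
rewrite exprMn in h2; have := sqr_ge0 (N z); lra.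
Qed.

(** The four products weight * ratio add up to 1. *)
Lemma weight_centre_sum (F : bool * bool -> R[i]) z n :
  \sum_b (weight n)%:C * F b - z = \sum_b (weight n)%:C * (F b - (ratio n)%:C * z).
Proof.
under [RHS]eq_bigr do rewrite mulrBr mulrA -rmorphM weight_ratio.
rewrite sumrB sumr_const card_prod card_bool -mulrnAl -rmorphMn.
suff -> : (1 / 4 : R) *+ (2 * 2) = 1 by rewrite rmorph1 mul1r.
by rewrite -mulr_natr; field.
Qed.

Lemma inv_centre_le z b : 7 / 5 <= N z ->
  N ((z - centre b)^-1 - z^-1) <= 28 / 29 / N z ^+ 2.
Proof.
move=> h; have fz := far_centre b h.
have z0 : 0 < N z by lra.
have c0 : 0 < N (z - centre b) by lra.
have -> : (z - centre b)^-1 - z^-1 = centre b / (z * (z - centre b)).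
  have zn : z != 0 by rewrite -normc_gt0.
  have cn : z - centre b != 0 by rewrite -normc_gt0.
  by field; rewrite ?zn ?cn.
rewrite Normc.normcM Normc.normcV Normc.normcM ler_pdivrMr ?mulr_gt0 //.
have c47 := @centre_le R b; apply: le_trans c47 _.
have -> : 28 / 29 / N z ^+ 2 * (N z * N (z - centre b)) = 28 / 29 * (N (z - centre b) / N z).
  by field; rewrite gt_eqF.
have : 29 / 49 <= N (z - centre b) / N z by rewrite ler_pdivlMr.
lra.
Qed.

Definition increment n d z := potential n d.+1 z - potential n d z.

Lemma incrementS n d z :
  increment n d.+1 z = \sum_b (weight n)%:C * increment n.+1 d (chart n b z).
Proof. by rewrite /increment /= -sumrB; apply: eq_bigr => b _; rewrite mulrBr. Qed.

(** Refining the measure keeps its mass, so the transforms of two consecutive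
    generations differ by O(1 / |z|^2) far away, and rescaling to deeper levels
    makes this geometrically small. *)
Lemma increment_far n d z : 7 / 5 <= N z -> N (increment n d z) <= (5 / 6) ^+ d / N z ^+ 2.
Proof.
elim: d n z => [|d IH] n z h; have z0 : 0 < N z by lra.
  rewrite /increment /= weight_centre_sum expr0; apply: le_trans (normc_wsum _ _) _.
  have -> : 1 / N z ^+ 2 = 4 * (1 / 4 / N z ^+ 2) by field; rewrite gt_eqF.
  apply: sum_centres_le => b.
  have kz : kernel z = z^-1 by rewrite /kernel ifT //; lra.
  have kc : kernel (chart n b z) = (ratio n)%:C * (z - centre b)^-1.
    rewrite /kernel ifT; last by have := chart_far n b h; lra.
    by rewrite /chart invfM invrK mulrC.
  rewrite kz kc -mulrBr Normc.normcM normc_real gtr0_norm ?ratio_gt0 //.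
  rewrite mulrA weight_ratio; have := inv_centre_le b h.
  have : 0 <= (N z ^+ 2)^-1 by rewrite invr_ge0 sqr_ge0.
  lra.
rewrite incrementS; apply: le_trans (normc_wsum _ _) _.
have -> : (5 / 6) ^+ d.+1 / N z ^+ 2 = 4 * ((5 / 6) ^+ d * (5 / 24) / N z ^+ 2).
  by rewrite exprS; field; rewrite gt_eqF.
apply: sum_centres_le => b.
have hb := IH n.+1 _ (chart_far n b h).
apply: le_trans (_ : _ <= weight n * ((5 / 6) ^+ d * (ratio n * (5 / 6) / N z ^+ 2))) _.
  rewrite ler_pM2l ?weight_gt0 //; apply: le_trans hb _.
  rewrite ler_pM2l ?exprn_gt0 // normc_chart -exprVn invf_div.
  exact: ratio_far_sqr.
have -> : weight n * ((5 / 6) ^+ d * (ratio n * (5 / 6) / N z ^+ 2)) =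
    (weight n * ratio n) * ((5 / 6) ^+ d * (5 / 6) / N z ^+ 2) by ring.
rewrite weight_ratio; lra.
Qed.

(** Sup-norm bound on the increments: at most one of the four charts brings z
    near the smaller set, where the bound of the next level is used; the other
    three fall under the far estimate. *)
Fixpoint increment_bound n d : R :=
  if d is d'.+1 then weight n * increment_bound n.+1 d' + 3 * (5 / 6) ^+ d' else 5.

Lemma increment_bound_ge0 n d : 0 <= increment_bound n d.
Proof.
elim: d n => [|d IH] n //=.
by rewrite addr_ge0 ?mulr_ge0 ?exprn_ge0 // ltW // weight_gt0.
Qed.

Lemma sum_centresD1 (F : bool * bool -> R) b0 x M : F b0 <= x ->
  (forall b, b != b0 -> F b <= M) -> \sum_b F b <= x + 3 * M.
Proof.
move=> h0 h; rewrite (bigD1 b0) //= lerD //.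
apply: le_trans (ler_sum _ h) _.
by rewrite sumr_const cardC1 card_prod card_bool mulr_natl.
Qed.

Lemma increment_le n d z : N (increment n d z) <= increment_bound n d.
Proof.
elim: d n z => [|d IH] n z /=.
  rewrite /increment /=; apply: le_trans (normcB _ _) _.
  apply: le_trans (_ : _ <= 4 * 1 + 1) _; last lra.
  apply: lerD (kernel_le1 z); apply: le_trans (normc_wsum _ _) _.
  apply: sum_centres_le => b; rewrite -[1]mulr1.
  by apply: ler_pM; rewrite ?normc_ge0 ?kernel_le1 ?(ltW (weight_gt0 _)) ?(ltW (weight_lt1 _)).
rewrite incrementS; apply: le_trans (normc_wsum _ _) _.
apply: (sum_centresD1 (b0 := quadrant z)); first by rewrite ler_pM2l ?weight_gt0.
move=> b /(chart_other_far n) hb; have := increment_far n.+1 d hb.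
have nb : 1 <= N (chart n b z) ^+ 2 by rewrite exprn_ege1 //; lra.
move=> h; rewrite -[leRHS]mul1r.
apply: ler_pM; rewrite ?normc_ge0 ?(ltW (weight_gt0 _)) ?(ltW (weight_lt1 _)) //.
apply: le_trans h _; rewrite ler_piMr ?exprn_ge0 // invf_le1 //; lra.
Qed.

(** With a_n = (n + 15)^2 one has weight n = a_n / a_(n+1), and the partial sums
    obey S(n) <= 23 + (a_n / a_(n+1)) S(n + 1), whose solution is at most
    23 a_n times the sum of 1 / a_k for k >= n.  This is where the quadratic
    growth of a_n is used. *)
Lemma increment_bound_sum n D :
  \sum_(0 <= d < D) increment_bound n d <= 23 * (n%:R + 15) ^+ 2 / (n%:R + 14).
Proof.
elim: D n => [|D IH] n; have n0 : 0 <= n%:R :> R by [].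
  by rewrite big_geq // divr_ge0 ?mulr_ge0 ?exprn_ge0 //; lra.
rewrite big_nat_recl //= big_split /= -!mulr_sumr.
(* three times this sum, and the increment 5 of generation 0, make up the 23 *)
have geo : \sum_(0 <= d < D) (5 / 6 : R) ^+ d <= 6.
  suff : \sum_(0 <= d < D) (5 / 6 : R) ^+ d = 6 - 6 * (5 / 6) ^+ D.
    by move=> ->; rewrite gerBl mulr_ge0 ?exprn_ge0.
  elim: D {IH} => [|D IH]; first by rewrite big_geq // expr0; lra.
  by rewrite big_nat_recr //= IH exprS; lra.
have h := IH n.+1.
have {h} : weight n * \sum_(0 <= d < D) increment_bound n.+1 d <= 23 * (n%:R + 15).
  apply: le_trans (ler_wpM2l (ltW (weight_gt0 n)) h) _.
  rewrite /weight /ratio -natr1 le_eqVlt; apply/orP; left; apply/eqP; field.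
  by rewrite !gt_eqF //; lra.
have : 23 * (n%:R + 16) <= 23 * (n%:R + 15) ^+ 2 / (n%:R + 14) :> R.
  by rewrite ler_pdivlMr; [rewrite expr2; lra|lra].
lra.
Qed.

(** Uniform convergence, phrased with the partial sums S of the sup-norm bounds. *)
Lemma potential_cauchy : exists S : nat -> R,
  [/\ S 0%N = 0, forall D, S D <= 370,
    forall e : R, 0 < e -> exists n0, forall m n,
      (n0 <= m)%N -> (m <= n)%N -> S n - S m <= e &
    forall m n z, (m <= n)%N -> N (potential 0 n z - potential 0 m z) <= S n - S m].
Proof.
(* increment_bound_sum at n = 0 gives 23 * 225 / 14 < 370 *)
pose S D : R := \sum_(0 <= d < D) increment_bound 0 d.
have S370 D : S D <= 370 by have := increment_bound_sum 0 D; rewrite !add0r expr2 -/(S D); lra.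
have Sm m n : (m <= n)%N -> S m <= S n.
  by move=> mn; rewrite /S (big_cat_nat (leq0n m) mn) //= lerDl sumr_ge0 // => i _; exact: increment_bound_ge0.
exists S; split=> //.
- by rewrite /S big_geq.
- have : cvgn S.
    apply: nondecreasing_is_cvgn; first by move=> m n; exact: Sm.
    by exists 370 => _ [D _ <-].
  move=> /cvg_ex[l /cvgrPdist_le Sl] e e0.
  have [n0 _ h] := Sl (e / 2) ltac:(lra).
  exists n0 => m n m0 mn.
  have h1 := h m m0; have h2 := h n (leq_trans m0 mn).
  rewrite /= !ler_norml in h1 h2; lra.
- move=> m n z /subnK <-; elim: (n - m)%N => [|k IH].
    by rewrite !subrr Normc.normc0.
  rewrite addSn; have := normcD (increment 0 (k + m) z) (potential 0 (k + m) z - potential 0 m z).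
  rewrite /increment addrA subrK => /le_trans; apply.
  have -> : S (k + m).+1 = S (k + m)%N + increment_bound 0 (k + m) by rewrite /S big_nat_recr.
  by have := increment_le 0 (k + m) z; rewrite /increment; lra.
Qed.

Definition cantor_potential z : R[i] := xget 0 [set l | clim (fun d => potential 0 d z) l].

Lemma potential_clim z : clim (fun d => potential 0 d z) (cantor_potential z).
Proof.
suff [l hl] : exists l, clim (fun d => potential 0 d z) l by exact: (xgetPex 0 (ex_intro _ l hl)).
have [S [_ _ SC SP]] := potential_cauchy.
apply: ccauchy_clim => e /SC[n0 h]; exists n0 => m n hm hn.
case/orP: (leq_total m n) => mn.
  by rewrite normcBC; apply: le_trans (SP _ _ z mn) _; exact: h.
by apply: le_trans (SP _ _ z mn) _; exact: h.
Qed.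

Lemma cantor_potential_le z : N (cantor_potential z) <= 371.
Proof.
have [S [S0 S370 _ SP]] := potential_cauchy.
have := @clim_le R _ _ 0 371 0%N (potential_clim z); rewrite subr0; apply=> n _.
rewrite subr0; have := SP _ _ z (leq0n n); rewrite S0 subr0 => h.
have := normcD (potential 0 n z - potential 0 0 z) (potential 0 0 z); rewrite subrK.
have := kernel_le1 z; have := S370 n => /=; lra.
Qed.

Lemma cantor_potential_continuous z : continuous_pt cantor_potential z.
Proof.
move=> e e0; have [S [_ _ SC SP]] := potential_cauchy.
have [n0 h] := SC (e / 4) ltac:(lra).
have near w : N (cantor_potential w - potential 0 n0 w) <= e / 4.
  apply: (clim_le (n0 := n0) (potential_clim w)) => n nn.
  by apply: le_trans (SP _ _ w nn) _; exact: h.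
have [L L0 hL] := potential_lipschitz 0 n0.
have L1 : 0 < 4 * (1 + L) by lra.
exists (e / (4 * (1 + L))); first exact: divr_gt0.
move=> w; rewrite ltr_pdivlMr // => hw.
have h1 := near w; have h2 := near z; rewrite normcBC in h2; have h3 := hL w z.
have h4 : L * N (w - z) <= e / 4 by have := normc_ge0 (w - z); lra.
have := normcD (cantor_potential w - potential 0 n0 w) (potential 0 n0 w - potential 0 n0 z).
have := normcD (cantor_potential w - potential 0 n0 z) (potential 0 n0 z - cantor_potential z).
rewrite !addrA !subrK; lra.
Qed.

(** The coefficient 6 is reproduced by the recursion: moving the centres costs at most
    28 / 29 < 1 and the rescaled error of the next level at most 5. *)
Lemma potential_infty n d z : 7 / 5 <= N z -> N (potential n d z - z^-1) <= 6 / N z ^+ 2.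
Proof.
elim: d n z => [|d IH] n z h; have z0 : 0 < N z by lra.
  rewrite /= /kernel ifT; last lra.
  by rewrite subrr Normc.normc0 divr_ge0 ?sqr_ge0.
rewrite /= weight_centre_sum; apply: le_trans (normc_wsum _ _) _.
have -> : 6 / N z ^+ 2 = 4 * (1 / 4 * 6 / N z ^+ 2) by field; rewrite gt_eqF.
apply: sum_centres_le => b.
have r0 := @ratio_gt0 R n.
have zc : 0 < N (z - centre b) by have := far_centre b h; lra.
have -> : potential n.+1 d (chart n b z) - (ratio n)%:C / z =
   (potential n.+1 d (chart n b z) - (chart n b z)^-1) +
   (ratio n)%:C * ((z - centre b)^-1 - z^-1).
  rewrite /chart invfM invrK; ring.
apply: le_trans (ler_wpM2l (ltW (weight_gt0 n)) (normcD _ _)) _.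
rewrite Normc.normcM normc_real gtr0_norm // mulrDr mulrA weight_ratio.
have h1 := inv_centre_le b h.
have h2 := IH n.+1 _ (chart_far n b h).
rewrite normc_chart -exprVn (invf_div (N _)) in h2.
have h3 := ratio_far_sqr n b h.
have h4 : weight n * N (potential n.+1 d (chart n b z) - (chart n b z)^-1)
   <= 1 / 4 * 5 / N z ^+ 2.
  apply: le_trans (_ : _ <= weight n * (6 * (ratio n * (5 / 6) / N z ^+ 2))) _.
    by rewrite ler_pM2l ?weight_gt0 //; apply: le_trans h2 _; rewrite ler_pM2l.
  have -> : weight n * (6 * (ratio n * (5 / 6) / N z ^+ 2)) = (weight n * ratio n) * (5 / N z ^+ 2).
    by field; rewrite gt_eqF.
  by rewrite weight_ratio; lra.
set X := (N z ^+ 2)^-1 in h1 h4 *; have X0 : 0 <= X by rewrite invr_ge0 sqr_ge0.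
lra.
Qed.

Lemma cantor_potential_infty z : 7 / 5 <= N z -> N (cantor_potential z - z^-1) <= 6 / N z ^+ 2.
Proof.
by move=> h; apply: (clim_le (n0 := 0) (potential_clim z)) => n _; exact: potential_infty.
Qed.

(** The bound 2 |h|^2 / e^3 is that of 1 / z at distance e from its pole; it is
    invariant under the rescaling of a chart together with that of the
    transform, so it does not depend on the generation. *)
Lemma potential_second_order n d z e : 0 < e -> away n d z e ->
  second_order_at (potential n d) z (e / 2) (2 / e ^+ 3).
Proof.
elim: d n z e => [|d IH] n z e e0 aw.
  have z1 : 1 + e <= N z.
    have [z1|z1] := leP (N z) 1; first by have := aw z z1; rewrite subrr Normc.normc0; lra.
    have nz : 0 < N z by lra.
    have := aw (z / (N z)%:C); rewrite /= Normc.normcM Normc.normcV normc_real gtr0_norm //.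
    rewrite divff ?gt_eqF // => /(_ (lexx _)).
    have -> : z - z / (N z)%:C = z * ((N z - 1) / N z)%:C.
      rewrite !rmorphM rmorphB rmorph1 fmorphV; field.
      by rewrite -normc_eq0 normc_real normr_eq0 gt_eqF.
    rewrite Normc.normcM normc_real ger0_norm; last by rewrite divr_ge0; lra.
    by rewrite mulrC divfK ?gt_eqF //; lra.
  exists (- (z ^- 2)) => h he.
  have zh : N z - e / 2 <= N (z + h).
    by have := normcB (z + h) h; rewrite addrK; lra.
  rewrite /= /kernel !ifT; try lra.
  have zn : z != 0 by rewrite -normc_gt0; lra.
  have zhn : z + h != 0 by rewrite -normc_gt0; lra.
  have -> : (z + h)^-1 - z^-1 - h * - z ^- 2 = h ^+ 2 * (z ^+ 2 * (z + h))^-1.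
    by field; rewrite zn zhn.
  rewrite Normc.normcM normcX Normc.normcV Normc.normcM normcX mulrC.
  rewrite ler_wpM2r ?exprn_ge0 ?normc_ge0 //.
  have -> : 2 / e ^+ 3 = (e ^+ 2 * (e / 2))^-1 by field; rewrite gt_eqF.
  have p1 : 0 < e ^+ 2 * (e / 2) by rewrite mulr_gt0 ?exprn_gt0 ?divr_gt0.
  have p2 : 0 < N z ^+ 2 * N (z + h) by rewrite mulr_gt0 ?exprn_gt0 ?normc_gt0.
  rewrite lef_pV2 ?posrE //.
  have e0' := ltW e0; have ez : e <= N z by lra.
  have ezh : e / 2 <= N (z + h) by lra.
  by apply: ler_pM; rewrite ?exprn_ge0 ?divr_ge0 // !expr2 ler_pM.
have r0 := @ratio_gt0 R n.
have H b : second_order_at (potential n.+1 d) (chart n b z) (e / ratio n / 2) (2 / (e / ratio n) ^+ 3).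
  apply: IH; first exact: divr_gt0.
  move=> u hu; have := aw (centre b + (ratio n)%:C * u).
  have hc : generation n d.+1 (centre b + (ratio n)%:C * u) by exists b; rewrite chart_inv.
  move=> /(_ hc); rewrite -{1}(chartK n b z).
  have -> : centre b + (ratio n)%:C * chart n b z - (centre b + (ratio n)%:C * u) =
     (ratio n)%:C * (chart n b z - u) by ring.
  by rewrite Normc.normcM normc_real gtr0_norm // ler_pdivrMr // mulrC.
pose l b := sval (cid (H b)).
have hl b : forall h, N h <= e / ratio n / 2 ->
    N (potential n.+1 d (chart n b z + h) - potential n.+1 d (chart n b z) - h * l b) <=
    2 / (e / ratio n) ^+ 3 * N h ^+ 2.
  by rewrite /l; case: (cid (H b)).
exists (\sum_b (weight n)%:C * (l b / (ratio n)%:C)) => h he.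
rewrite /= mulr_sumr -!sumrB.
have E b : (weight n)%:C * potential n.+1 d (chart n b (z + h)) -
    (weight n)%:C * potential n.+1 d (chart n b z) -
    h * ((weight n)%:C * (l b / (ratio n)%:C)) =
    (weight n)%:C * (potential n.+1 d (chart n b z + h / (ratio n)%:C) -
      potential n.+1 d (chart n b z) - h / (ratio n)%:C * l b).
  have -> : chart n b (z + h) = chart n b z + h / (ratio n)%:C.
    by rewrite /chart -mulrDl addrAC.
  by ring.
under eq_bigr do rewrite E.
apply: le_trans (normc_wsum _ _) _.
have nh : N (h / (ratio n)%:C) = N h / ratio n.
  by rewrite Normc.normcM Normc.normcV normc_real gtr0_norm.
have -> : 2 / e ^+ 3 * N h ^+ 2 = 4 * (weight n * (2 / (e / ratio n) ^+ 3 * (N h / ratio n) ^+ 2)).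
  by rewrite /weight; field; rewrite !gt_eqF.
apply: sum_centres_le => b; rewrite ler_pM2l ?weight_gt0 // -nh.
by apply: hl; rewrite nh mulrAC ler_pM2r ?invr_gt0.
Qed.

Lemma cantor_potential_cdiff z : ~ cantor 0 z -> cdifferentiable cantor_potential z.
Proof.
move=> /not_cantor_away[e e0 [d0 h]].
have e2 : 0 < e / 2 by lra.
have M0 : 0 <= 2 / e ^+ 3 by rewrite divr_ge0 // exprn_ge0 // ltW.
apply: (second_order_cdifferentiable e2).
apply: (second_order_lim (g := potential 0) (n0 := d0)) e2 M0 _ _.
  by move=> w _; exact: potential_clim.
by move=> d /h; exact: potential_second_order.
Qed.

End Potential.

(** * The holomorphic motion *)

Section Motion.
Variable R : realType.
Implicit Types (r e t : R) (z w l : R[i]) (b : bool * bool).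
Local Open Scope complex_scope.

Definition bump t : R := Num.max 0 (Num.min 1 ((2 / 5 - t) * (35 / 4))).

Lemma bump_bounds t : 0 <= bump t <= 1.
Proof. by rewrite /bump le_max lexx /= ge_max ler01 ge_min lexx. Qed.

Lemma bump1 t : t <= 2 / 7 -> bump t = 1.
Proof.
move=> h; rewrite /bump min_l; last by lra.
by rewrite max_r // ler01.
Qed.

Lemma bump0 t : 2 / 5 <= t -> bump t = 0.
Proof.
by move=> h; rewrite /bump max_l // ge_min; apply/orP; right; lra.
Qed.

Lemma bump_lipschitz t t' : `|bump t - bump t'| <= 35 / 4 * `|t - t'|.
Proof.
rewrite /bump !maxEle !minEle; set a := (2 / 5 - t) * (35 / 4); set a' := (2 / 5 - t') * (35 / 4).
have -> : 35 / 4 * `|t - t'| = `|a - a'|.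
  have -> : a - a' = 35 / 4 * (t' - t) by rewrite /a /a'; ring.
  by rewrite normrM distrC (ger0_norm (_ : 0 <= 35 / 4)) //; lra.
have n0 : 0 <= `|a - a'| by [].
have := ler_norm (a - a'); have := ler_norm (a' - a); rewrite (distrC a' a) => h1 h2.
rewrite ler_norml; clearbody a a'.
case: (leP 1 a) => ha; case: (leP 1 a') => ha'.
all: rewrite ?ler01.
all: try case: (leP 0 a) => hb; try case: (leP 0 a') => hb'; lra.
Qed.

Definition radial_bump w : R[i] := w * (bump (N w))%:C.

Lemma radial_bump_lipschitz z w : N (radial_bump z - radial_bump w) <= 9 / 2 * N (z - w).
Proof.
have main (x y : R[i]) : N y <= 2 / 5 -> N (radial_bump x - radial_bump y) <= 9 / 2 * N (x - y).
  move=> hy.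
  have -> : radial_bump x - radial_bump y =
     (x - y) * (bump (N x))%:C + y * (bump (N x) - bump (N y))%:C.
    by rewrite /radial_bump rmorphB /=; ring.
  apply: le_trans (normcD _ _) _; rewrite !Normc.normcM !normc_real.
  have /andP[b0 b1] := bump_bounds (N x); rewrite ger0_norm //.
  have h1 : N (x - y) * bump (N x) <= N (x - y) by rewrite ler_piMr ?normc_ge0.
  have h2 : `|bump (N x) - bump (N y)| <= 35 / 4 * N (x - y).
    apply: le_trans (bump_lipschitz _ _) _; rewrite ler_pM2l //.
    by rewrite ler_norml normc_sub_ge andbT lerNl opprB normcBC normc_sub_ge.
  have h3 : N y * `|bump (N x) - bump (N y)| <= 2 / 5 * (35 / 4 * N (x - y)).
    by apply: ler_pM; rewrite ?normc_ge0.
  lra.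
have [hw|hw] := leP (N w) (2 / 5); first exact: main.
have [hz|hz] := leP (N z) (2 / 5); first by rewrite normcBC [N (z - w)]normcBC; exact: main.
rewrite /radial_bump (bump0 (ltW hw)) (bump0 (ltW hz)) !mulr0 subrr Normc.normc0.
by rewrite mulr_ge0 ?normc_ge0.
Qed.

(** Near the four centres the shift is z - centre b, and it vanishes at distance
    at least 2 / 5 from all of them, so that pinching by it multiplies four
    disjoint discs and fixes the points far from them. *)
Definition shift z : R[i] := \sum_b radial_bump (z - centre b).

Lemma shiftE z : shift z = radial_bump (z - centre (quadrant z)).
Proof.
rewrite /shift (bigD1 (quadrant z)) //= big1 ?addr0 // => b /other_centre_far h.
by rewrite /radial_bump bump0 // mulr0.
Qed.

Lemma shift_le z : N (shift z) <= 2 / 5.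
Proof.
rewrite shiftE /radial_bump; set w := z - _; have [h|h] := leP (2 / 5) (N w).
  by rewrite bump0 // mulr0 Normc.normc0.
rewrite Normc.normcM normc_real; have /andP[b0 b1] := bump_bounds (N w).
rewrite ger0_norm //; apply: le_trans (ltW h); by rewrite ler_piMr ?normc_ge0.
Qed.

Lemma shift_lipschitz z w : N (shift z - shift w) <= 18 * N (z - w).
Proof.
rewrite /shift -sumrB; apply: le_trans (normc_sum _ _ _) _.
have -> : 18 * N (z - w) = 4 * (9 / 2 * N (z - w)) by field.
apply: sum_centres_le => b; apply: le_trans (radial_bump_lipschitz _ _) _.
by have -> : z - centre b - (w - centre b) = z - w by ring.
Qed.

Definition pinch l z : R[i] := z - l / 20 * shift z.
Definition multiplier l : R[i] := 1 - l / 20.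

Lemma normc_div20 l : N (l / 20) = N l / 20.
Proof.
rewrite Normc.normcM Normc.normcV; congr (_ / _).
by rewrite -(rmorph_nat (real_complex R)) normc_real ger0_norm.
Qed.

(** 18 / 20 < 1. *)
Lemma pinch_inj l : N l <= 1 -> injective (pinch l).
Proof.
move=> l1 z w /eqP; rewrite -subr_eq0 /pinch => /eqP h.
have E : z - w = l / 20 * (shift z - shift w).
  apply/eqP; rewrite -subr_eq0; apply/eqP; rewrite -h; ring.
have := congr1 (@Normc.normc R) E; rewrite Normc.normcM normc_div20 => E2.
have h1 := shift_lipschitz z w.
have h2 : N l / 20 * N (shift z - shift w) <= 1 / 20 * (18 * N (z - w)).
  by apply: ler_pM; rewrite ?normc_ge0 ?divr_ge0 ?normc_ge0 //; lra.
have := normc_ge0 (z - w) => h3.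
by apply/eqP; rewrite -subr_eq0 -normc_eq0; apply/eqP; lra.
Qed.

Lemma pinch_centre l z b : N (z - centre b) <= 2 / 7 ->
  pinch l z = centre b + multiplier l * (z - centre b).
Proof.
move=> h; have bq : b = quadrant z by apply: near_centre; lra.
rewrite /pinch shiftE -bq /radial_bump bump1 // rmorph1 mulr1 /multiplier; ring.
Qed.

Lemma multiplier_le l : N l <= 1 -> N (multiplier l) <= 21 / 20.
Proof.
by move=> h; apply: le_trans (normcB _ _) _; rewrite Normc.normc1 normc_div20; lra.
Qed.

Lemma pinch_le1 l z : N l <= 1 -> N z <= 1 -> N (pinch l z) <= 1.
Proof.
move=> l1 z1; rewrite /pinch shiftE; set c := centre _.
have [h|h] := leP (2 / 5) (N (z - c)).
  by rewrite /radial_bump bump0 // !mulr0 subr0.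
have -> : z - l / 20 * radial_bump (z - c) = c + (z - c) - l / 20 * radial_bump (z - c) by ring.
have := normcB (c + (z - c)) (l / 20 * radial_bump (z - c)).
have := normcD c (z - c); have := @centre_le R (quadrant z); rewrite -/c.
have : N (l / 20 * radial_bump (z - c)) <= 1 / 20 * (2 / 5).
  rewrite Normc.normcM normc_div20; apply: ler_pM; rewrite ?divr_ge0 ?normc_ge0 //; first by lra.
  by have := shift_le z; rewrite shiftE.
lra.
Qed.

(** Pinching multiplies each of the four discs by the multiplier; inside the
    image of a disc, the motion of the next level is inserted. *)
Fixpoint motion_approx n d l z : R[i] :=
  if d is d'.+1 then
    if N (z - centre (quadrant z)) <= ratio n then
      centre (quadrant z) +
        (ratio n)%:C * multiplier l * motion_approx n.+1 d' l (chart n (quadrant z) z)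
    else pinch l z
  else z.

Lemma ratio_multiplier_le n l : N l <= 1 -> N ((ratio n)%:C * multiplier l) <= 3 / 10.
Proof.
move=> l1; rewrite Normc.normcM normc_real gtr0_norm ?ratio_gt0 //.
apply: le_trans (_ : _ <= 2 / 7 * (21 / 20)) _; last by lra.
by apply: ler_pM; rewrite ?normc_ge0 ?ratio_le ?multiplier_le // ltW // ratio_gt0.
Qed.

Lemma inner_chart_le1 n b z : N (z - centre b) <= ratio n -> N (chart n b z) <= 1.
Proof. by rewrite normc_chart ler_pdivrMr ?ratio_gt0 // mul1r. Qed.

Lemma motion_approx_le1 n d l z : N l <= 1 -> N z <= 1 -> N (motion_approx n d l z) <= 1.
Proof.
move=> l1; elim: d n z => [|d IH] n z z1 //=.
case: (leP (N (z - centre (quadrant z))) (ratio n)) => h; last exact: pinch_le1.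
apply: le_trans (normcD _ _) _; rewrite Normc.normcM.
have h1 := IH n.+1 _ (inner_chart_le1 h).
have h2 := ratio_multiplier_le n l1.
have := ler_pM (normc_ge0 _) (normc_ge0 _) h2 h1.
have := @centre_le R (quadrant z); lra.
Qed.

Lemma motion_approx_step n d l z : N l <= 1 ->
  N (motion_approx n d.+1 l z - motion_approx n d l z) <= (1 / 2) ^+ d.
Proof.
move=> l1; elim: d n z => [|d IH] n z.
  rewrite /= expr0; case: (leP (N (z - centre (quadrant z))) (ratio n)) => h.
    set c := centre _ in h *.
    have -> : c + (ratio n)%:C * multiplier l * chart n (quadrant z) z - z = - (l / 20 * (z - c)).
      by rewrite /chart -/c /multiplier; field; exact: ratioC_neq0.
    rewrite normcN Normc.normcM normc_div20 -[1]mulr1.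
    by apply: ler_pM; rewrite ?divr_ge0 ?normc_ge0 //; have := @ratio_le R n; lra.
  rewrite /pinch addrAC subrr add0r normcN Normc.normcM normc_div20 -[1]mulr1.
  by apply: ler_pM; rewrite ?divr_ge0 ?normc_ge0 //; have := shift_le z; lra.
rewrite [in motion_approx n d.+2 l z]/= -/(motion_approx n.+1 d.+1) [motion_approx n d.+1 l z]/=.
case: (leP (N (z - centre (quadrant z))) (ratio n)) => h; last first.
  by rewrite subrr Normc.normc0 exprn_ge0.
rewrite opprD addrACA subrr add0r -mulrBr Normc.normcM exprS.
have h2 := ratio_multiplier_le n l1.
apply: ler_pM; rewrite ?normc_ge0 //; last exact: IH.
lra.
Qed.

Lemma motion_approx_cauchy n l z m k : N l <= 1 ->
  N (motion_approx n (m + k) l z - motion_approx n m l z) <= 2 * (1 / 2) ^+ m - 2 * (1 / 2) ^+ (m + k).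
Proof.
move=> l1; elim: k => [|k IH]; first by rewrite addn0 !subrr Normc.normc0.
rewrite addnS; have := motion_approx_step n (m + k) z l1.
have := normcD (motion_approx n (m + k).+1 l z - motion_approx n (m + k) l z)
  (motion_approx n (m + k) l z - motion_approx n m l z).
rewrite addrA subrK exprS; lra.
Qed.

Definition motion n l z : R[i] := xget 0 [set w | clim (fun d => motion_approx n d l z) w].

Lemma motion_clim n l z : N l <= 1 -> clim (fun d => motion_approx n d l z) (motion n l z).
Proof.
move=> l1.
suff [w hw] : exists w, clim (fun d => motion_approx n d l z) w by exact: (xgetPex 0 (ex_intro _ w hw)).
apply: ccauchy_clim => e e0.
have h01 : 0 <= (1 / 2 : R) < 1 by lra.
have [n0 h0] := geometric_small 2 h01 e0.
have main m k : (n0 <= m)%N -> (m <= k)%N -> N (motion_approx n k l z - motion_approx n m l z) <= e.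
  move=> hm /subnKC <-; apply: le_trans (motion_approx_cauchy _ _ _ _ l1) _.
  have := h0 m hm; have : 0 <= (1 / 2 : R) ^+ (m + (k - m)) by rewrite exprn_ge0.
  lra.
exists n0 => m k hm hk; case/orP: (leq_total m k) => mk; last exact: main.
by rewrite normcBC; exact: main.
Qed.

Lemma motionE n l z : N l <= 1 -> motion n l z =
  if N (z - centre (quadrant z)) <= ratio n then
    centre (quadrant z) + (ratio n)%:C * multiplier l * motion n.+1 l (chart n (quadrant z) z)
  else pinch l z.
Proof.
move=> l1; apply: (clim_unique (motion_clim n z l1)).
have shiftS u w : clim (fun d => u d.+1) w -> clim u w.
  by move=> h e /h[n0 h0]; exists n0.+1 => -[|k] //; exact: h0.
apply: shiftS => /=; case: ifP => _; last exact: clim_cst.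
by apply: clim_affine; exact: motion_clim.
Qed.

Lemma motion_le1 n l z : N l <= 1 -> N z <= 1 -> N (motion n l z) <= 1.
Proof.
move=> l1 z1; have := @clim_le R _ _ 0 1 0%N (motion_clim n z l1); rewrite subr0; apply=> d _.
by rewrite subr0 motion_approx_le1.
Qed.

Lemma motion0 n z : motion n 0 z = z.
Proof.
have N0 : N (0 : R[i]) <= 1 by rewrite Normc.normc0.
apply: (clim_unique (motion_clim n z N0)).
suff H d : motion_approx n d 0 z = z.
  by apply: (eq_clim (n0 := 0)) (clim_cst z) => d _; rewrite H.
elim: d n z => [|d IH] n z //=; case: ifP => _.
  by rewrite IH /multiplier mul0r subr0 mulr1 chartK.
by rewrite /pinch mul0r mul0r subr0.
Qed.

(** On an inner disc the motion is the pinching composed with a self-map E of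
    that disc, and E is the identity elsewhere.  As the pinching is injective,
    equal images have equal images under E, so the two points lie in the same
    inner disc unless they are equal. *)
Lemma motion_eq n l z w : N l <= 1 -> motion n l z = motion n l w ->
  z = w \/ exists b, [/\ N (z - centre b) <= ratio n, N (w - centre b) <= ratio n &
    motion n.+1 l (chart n b z) = motion n.+1 l (chart n b w)].
Proof.
move=> l1.
pose E z := if N (z - centre (quadrant z)) <= ratio n then
    centre (quadrant z) + (ratio n)%:C * motion n.+1 l (chart n (quadrant z) z) else z.
have Ein x : N (x - centre (quadrant x)) <= ratio n ->
    E x = centre (quadrant x) + (ratio n)%:C * motion n.+1 l (chart n (quadrant x) x).
  by rewrite /E => ->.
have Eout x : ~~ (N (x - centre (quadrant x)) <= ratio n) -> E x = x.
  by rewrite /E => /negbTE ->.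
have inner x : N (x - centre (quadrant x)) <= ratio n ->
    N (E x - centre (quadrant x)) <= ratio n.
  move=> h; rewrite Ein // addrAC subrr add0r Normc.normcM normc_real gtr0_norm ?ratio_gt0 //.
  by rewrite ler_piMr ?(ltW (ratio_gt0 _ _)) // motion_le1 // inner_chart_le1.
have r27 := @ratio_le R n.
have quadE x : N (x - centre (quadrant x)) <= ratio n -> quadrant x = quadrant (E x).
  by move=> /inner h; apply: near_centre; lra.
have GE x : motion n l x = pinch l (E x).
  rewrite motionE //; case: ifP => [h|/negbT/Eout -> //].
  rewrite (@pinch_centre _ _ (quadrant x)); last exact: le_trans (inner x h) r27.
  by rewrite Ein // addrAC subrr add0r mulrCA mulrA.
rewrite !GE => /(pinch_inj l1) EE.
have [hz|hz] := boolP (N (z - centre (quadrant z)) <= ratio n);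
have [hw|hw] := boolP (N (w - centre (quadrant w)) <= ratio n).
- right; exists (quadrant z).
  have qzw : quadrant z = quadrant w by rewrite (quadE z hz) EE -quadE.
  split=> //; first by rewrite qzw.
  move: EE; rewrite !Ein // -qzw => /addrI; apply: mulfI; exact: ratioC_neq0.
- by have := inner z hz; rewrite (quadE z hz) EE (Eout w hw) (negbTE hw).
- by have := inner w hw; rewrite (quadE w hw) -EE (Eout z hz) (negbTE hz).
- by left; rewrite -(Eout z hz) EE Eout.
Qed.

(** Two points with the same image stay in common discs of all generations. *)
Lemma motion_contract n l z w d : N l <= 1 -> motion n l z = motion n l w ->
  N (z - w) <= 2 * (2 / 7) ^+ d.
Proof.
move=> l1; elim: d n z w => [|d IH] n z w /(motion_eq l1)[->|[b [hz hw h]]].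
- by rewrite subrr Normc.normc0.
- have := normcB (z - centre b) (w - centre b).
  have -> : z - centre b - (w - centre b) = z - w by ring.
  by rewrite expr0; have := @ratio_le R n; lra.
- by rewrite subrr Normc.normc0 mulr_ge0 // exprn_ge0.
- have := IH _ _ _ h; rewrite chartB Normc.normcM Normc.normcV normc_real gtr0_norm ?ratio_gt0 //.
  rewrite ler_pdivrMr ?ratio_gt0 // => /le_trans; apply.
  by rewrite exprSr mulrA ler_wpM2l ?ratio_le // mulr_ge0 // exprn_ge0.
Qed.

Lemma motion_inj n l : N l <= 1 -> injective (motion n l).
Proof.
move=> l1 z w h; apply/eqP; rewrite -subr_eq0 -normc_eq0 eq_le normc_ge0 andbT.
apply/ler_addgt0Pr => e e0; rewrite add0r.
have h01 : 0 <= (2 / 7 : R) < 1 by lra.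
have [n0 h0] := geometric_small 2 h01 e0.
exact: le_trans (motion_contract n0 l1 h) (ltW (h0 n0 (leqnn _))).
Qed.

(** The recursion multiplies by ratio n * multiplier, of modulus at most 3 / 10, so
    derivatives and remainders keep the bound 1. *)
Lemma motion_approx_second_order n d l z : N l <= 1 -> exists L, N L <= 1 /\
  forall h, N (l + h) <= 1 ->
  N (motion_approx n d (l + h) z - motion_approx n d l z - h * L) <= N h ^+ 2.
Proof.
move=> l1; elim: d n z => [|d IH] n z.
  exists 0; rewrite Normc.normc0; split=> // h _.
  by rewrite /= subrr mulr0 subr0 Normc.normc0 sqr_ge0.
rewrite /=; case: ifP => hin; last first.
  exists (- (shift z / 20)); split.
    by rewrite normcN normc_div20; have := shift_le z; lra.
  move=> h _; have -> : pinch (l + h) z - pinch l z - h * - (shift z / 20) = 0.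
    by rewrite /pinch; field.
  by rewrite Normc.normc0 sqr_ge0.
set c := centre _ in hin *; set x := chart _ _ _; set r := (ratio n)%:C.
have [L [L1 hL]] := IH n.+1 x.
have x1 : N x <= 1 by exact: inner_chart_le1.
pose y := motion_approx n.+1 d l x.
have y1 : N y <= 1 by exact: motion_approx_le1.
have rn : N r = ratio n by rewrite normc_real gtr0_norm ?ratio_gt0.
have r27 := @ratio_le R n; have r0 := @ratio_gt0 R n.
have m1 := multiplier_le l1.
exists (r * (multiplier l * L - y / 20)); split.
  have A : N (multiplier l * L - y / 20) <= 11 / 10.
    apply: le_trans (normcB _ _) _; rewrite Normc.normcM normc_div20.
    by have := ler_pM (normc_ge0 _) (normc_ge0 _) m1 L1; lra.
  by rewrite Normc.normcM rn; have := ler_pM (ltW r0) (normc_ge0 _) r27 A; lra.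
move=> h lh; have := hL h lh; rewrite -/y; set y' := motion_approx _ _ _ _ => hy.
have -> : c + r * multiplier (l + h) * y' - (c + r * multiplier l * y) -
    h * (r * (multiplier l * L - y / 20)) =
   r * (multiplier (l + h) * (y' - y - h * L) - h ^+ 2 * (L / 20)).
  by rewrite /multiplier; field.
rewrite Normc.normcM rn.
have h1 := normcB (multiplier (l + h) * (y' - y - h * L)) (h ^+ 2 * (L / 20)).
have h2 : N (multiplier (l + h) * (y' - y - h * L)) <= 21 / 20 * N h ^+ 2.
  by rewrite Normc.normcM; apply: ler_pM; rewrite ?normc_ge0 ?multiplier_le.
have h3 : N (h ^+ 2 * (L / 20)) <= 1 / 20 * N h ^+ 2.
  by rewrite Normc.normcM normc_div20 normcX mulrC ler_wpM2r ?sqr_ge0 //; lra.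
have h4 : N (multiplier (l + h) * (y' - y - h * L) - h ^+ 2 * (L / 20)) <= 11 / 10 * N h ^+ 2 by lra.
apply: le_trans (_ : _ <= 2 / 7 * (11 / 10 * N h ^+ 2)) _.
  by apply: ler_pM; rewrite ?normc_ge0 ?(ltW r0).
have := sqr_ge0 (N h); lra.
Qed.

Lemma motion_cdiff n l z : N l < 1 -> cdifferentiable (fun l => motion n l z) l.
Proof.
move=> l1; have e0 : 0 < 1 - N l by lra.
have lh h : N h <= 1 - N l -> N (l + h) <= 1.
  by move=> hh; have := normcD l h; lra.
apply: (second_order_cdifferentiable e0).
apply: (second_order_lim (g := fun d l => motion_approx n d l z) (n0 := 0)) e0 (@ler01 R) _ _.
  by move=> h /lh; exact: motion_clim.
move=> d _; have [L [_ hL]] := motion_approx_second_order n d z (ltW l1).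
by exists L => h /lh; rewrite mul1r; exact: hL.
Qed.

Definition moved_cantor n l : set R[i] := [set motion n l z | z in cantor n].

Lemma moved_cantor_piece n l w : N l <= 1 -> moved_cantor n l w ->
  exists b, exists2 w', moved_cantor n.+1 l w' &
    w = centre b + (ratio n)%:C * multiplier l * w'.
Proof.
move=> l1 [z cz <-]; have [x cx zE] := cantor_chart cz.
exists (quadrant z); exists (motion n.+1 l x); first by exists x.
have xE : chart n (quadrant z) z = x by rewrite {2}zE chart_inv.
rewrite motionE // xE ifT //.
apply: inner_of_chart; rewrite xE; have := cantor_norm cx; lra.
Qed.

Lemma moved_cantor_norm n l w : N l <= 1 -> moved_cantor n l w -> N w < 1.
Proof.
move=> l1 /(moved_cantor_piece l1)[b [w' [z cz <-] ->]].
apply: le_lt_trans (normcD _ _) _; rewrite Normc.normcM.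
have z1 : N z <= 1 by have := cantor_norm cz; lra.
have := ler_pM (normc_ge0 _) (normc_ge0 _) (ratio_multiplier_le n l1) (motion_le1 n.+1 l1 z1).
have := @centre_le R b; lra.
Qed.

Lemma moved_cantor0 n : moved_cantor n 0 = cantor n.
Proof.
apply/seteqP; split=> [_ [z cz <-]|z cz]; first by rewrite motion0.
by exists z => //; rewrite motion0.
Qed.

End Motion.

(** * Analytic capacities *)

Section Capacity.
Variable R : realType.
Implicit Types (r e t : R) (z w l : R[i]) (b : bool * bool).
Local Open Scope complex_scope.

Lemma normr_le1 z : (`|z| <= 1) = (N z <= 1).
Proof. by rewrite normr_normc -(rmorph1 (real_complex R)) lecR. Qed.

Lemma normr_lt1 z : (`|z| < 1) = (N z < 1).
Proof. by rewrite normr_normc -(rmorph1 (real_complex R)) ltcR. Qed.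

Lemma sphere_inv0 : sphere_inv (Some (0 : cplx R)) = None.
Proof. by rewrite /sphere_inv eqxx. Qed.

Lemma sphere_invV z : z != 0 -> sphere_inv (Some (z^-1 : cplx R)) = Some (z : cplx R).
Proof. by move=> z0; rewrite /sphere_inv invr_eq0 (negbTE z0) invrK. Qed.

(** Complements of closed discs are neighbourhoods of infinity. *)
Lemma nbhs_infty (P : set (sphere R)) M : P None ->
  (forall z, M < N z -> P (Some z)) -> nbhs (None : sphere R) P.
Proof.
move=> P0 PM; exists [set z : cplx R | N z <= M].
  have cl : closed [set z : cplx R | N z <= M].
    move=> z hz; rewrite /= leNgt; apply/negP => zM.
    have e0 : 0 < N z - M by lra.
    have [w [/= wM]] := hz _ (nbhs_disc z e0).
    by have := normc_sub_ge z w; rewrite normcBC; lra.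
  by split=> //; apply: (closed_bounded_compact (r := M)).
by move=> _ [[z /negP zM <-]|->] //; apply: PM; rewrite ltNge.
Qed.

(** The plane is not compact. *)
Lemma dnbhs_infty_proper : ProperFilter ((None : sphere R)^').
Proof.
apply: Build_ProperFilter => -[U [Uc _] hU].
have [r hr] := compact_normc_bounded Uc.
have h : ~ U (`|r| + 1)%:C.
  by move=> /hr; rewrite normc_real ger0_norm ?addr_ge0 //; have := ler_norm r; lra.
have := hU (Some ((`|r| + 1)%:C : cplx R)).
by apply=> //; left; exists ((`|r| + 1)%:C).
Qed.

Lemma cdiff_infty (f : sphere R -> cplx R) : analytic_at f None -> exists l,
  forall e : R, 0 < e -> exists M : R, forall z, M < N z ->
    N (f (Some z) - f None - l * z^-1) <= e / N z.
Proof.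
move=> /derivable_cdiffP[l hl]; exists l => e /hl[d d0 hd].
exists d^-1 => z hz.
have nz : 0 < N z by rewrite (lt_trans _ hz) // invr_gt0.
have z0 : z != 0 by rewrite -normc_gt0.
have := hd z^-1; rewrite Normc.normcV add0r sphere_inv0 sphere_invV // [z^-1 * l]mulrC; apply.
by rewrite invf_plt.
Qed.

Lemma deriv_inftyE (f : sphere R -> cplx R) l :
  (forall e : R, 0 < e -> exists M : R, forall z, M < N z ->
    N (f (Some z) - f None - l * z^-1) <= e / N z) -> deriv_infty f = l.
Proof.
move=> hl; have pf := dnbhs_infty_proper.
apply: cvg_lim; first exact: norm_hausdorff.
move=> A /nbhs_cplxP[e e0 hA].
have [M hM] := hl (e / 2) ltac:(lra).
apply: (@nbhs_infty _ (Num.max M 0)) => [|z]; first by rewrite eqxx.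
rewrite gt_max => /andP[hz z0] _; apply: hA => /=.
have zn : z != 0 by rewrite -normc_gt0.
have -> : z * (f (Some z) - f None) - l = z * (f (Some z) - f None - l * z^-1).
  by rewrite [RHS]mulrBr mulrCA mulfV // mulr1.
rewrite Normc.normcM; apply: le_lt_trans (ler_wpM2l (ltW z0) (hM z hz)) _.
by rewrite mulrC divfK ?gt_eqF //; lra.
Qed.

Lemma sphere_setC_some (S : set (cplx R)) (z : cplx R) : sphere_setC S (Some z) <-> ~ S z.
Proof.
split=> [h Sz|h [w Sw [wz]]]; first by apply: h; exists z.
by apply: h; rewrite -wz.
Qed.

Lemma sphere_setC_none (S : set (cplx R)) : sphere_setC S None.
Proof. by move=> [z _]. Qed.

Lemma analytic_on_cdiff S (f : sphere R -> cplx R) z : analytic_on (sphere_setC S) f ->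
  ~ S z -> cdifferentiable (fun z => f (Some z)) z.
Proof. by move=> fa /sphere_setC_some /fa /derivable_cdiffP. Qed.

Lemma deriv_infty_le_integral (S : set R[i]) (f : sphere R -> cplx R) :
  (forall w, S w -> N w < 1) -> analytic_on (sphere_setC S) f ->
  4 * N (deriv_infty f) <= N (square_integral (fun z => f (Some z)) 0 1).
Proof.
move=> S1 fa; have [l hl] := cdiff_infty (fa _ (@sphere_setC_none S)).
rewrite (deriv_inftyE hl) /square_integral /= !sub0r !add0r.
apply: (@residue_infty_le R (fun z => f (Some z)) (f None) l 1 ltr01 _ hl) => x y hxy.
apply: (analytic_on_cdiff fa) => /S1 h.
have := le_lt_trans (Re_le_normc _) h; have := le_lt_trans (Im_le_normc _) h => /=.
by rewrite !ltr_norml => h1 h2; move: hxy; rewrite h1 h2.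
Qed.

Lemma holo_off_of_analytic S (f : sphere R -> cplx R) : analytic_on (sphere_setC S) f ->
  (forall z, ~ S z -> N (f (Some z)) <= 1) -> holo_square_off (fun z => f (Some z)) S 0 1.
Proof.
move=> fa f1 x y _ _ h.
have nS : ~ S (x +i* y) by move=> Sxy; apply: h; exists (x +i* y); rewrite // rmorph1 add0r mul1r.
by split; [exact: analytic_on_cdiff fa nS|exact: f1].
Qed.

Lemma deriv_infty_le4 (S : set R[i]) (f : sphere R -> cplx R) :
  (forall w, S w -> N w < 1) -> analytic_on (sphere_setC S) f ->
  (forall z, ~ S z -> N (f (Some z)) <= 1) -> N (deriv_infty f) <= 4.
Proof.
move=> S1 fa f1; have := deriv_infty_le_integral S1 fa.
have S1' w : S w -> `|Re w| < 1 /\ `|Im w| < 1.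
  by move=> /S1 h; split; [exact: le_lt_trans (Re_le_normc _) h|exact: le_lt_trans (Im_le_normc _) h].
have := square_integral_le1 ltr01 S1' (holo_off_of_analytic fa f1); lra.
Qed.

Lemma bernoulli (x : R) n : 0 <= x -> 1 + n%:R * x <= (1 + x) ^+ n.
Proof.
move=> x0; elim: n => [|n IH]; first by rewrite mul0r addr0 expr0.
rewrite exprS -natr1; have : 0 <= n%:R * x * x by rewrite !mulr_ge0.
have : (1 + x) * (1 + n%:R * x) <= (1 + x) * (1 + x) ^+ n by rewrite ler_pM2l //; lra.
lra.
Qed.

(** Writing s = v^4, Bernoulli's inequality bounds (n + 15) v^n, and v^(2 n)
    remains. *)
Lemma poly_geometric_small (s e : R) : 0 < s < 1 -> 0 < e ->
  exists n, ((n%:R + 15) / 15) ^+ 2 * s ^+ n < e.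
Proof.
move=> /andP[s0 s1] e0.
pose u := Num.sqrt s; pose v := Num.sqrt u.
have u0 : 0 < u by rewrite sqrtr_gt0.
have v0 : 0 < v by rewrite sqrtr_gt0.
have uu : u ^+ 2 = s by rewrite sqr_sqrtr // ltW.
have vv : v ^+ 2 = u by rewrite sqr_sqrtr // ltW.
have u1 : u < 1 by rewrite -(@ltr_pXn2r _ 2) ?nnegrE ?(ltW u0) // uu expr1n.
have v1 : v < 1 by rewrite -(@ltr_pXn2r _ 2) ?nnegrE ?(ltW v0) // vv expr1n.
pose x := v^-1 - 1.
have x0 : 0 < x by rewrite subr_gt0 invf_gt1.
have x1 : 1 + x = v^-1 by rewrite addrC subrK.
pose C := 1 + (15 * x)^-1.
have C0 : 0 < C by rewrite addr_gt0 // invr_gt0 mulr_gt0.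
have bnd n : (n%:R + 15) / 15 * v ^+ n <= C.
  have vn : 0 < v ^+ n by rewrite exprn_gt0.
  rewrite -ler_pdivlMr // -exprVn -x1.
  apply: le_trans (ler_wpM2l (ltW C0) (bernoulli n (ltW x0))).
  have -> : C * (1 + n%:R * x) = (n%:R + 15) / 15 + n%:R * x + (15 * x)^-1.
    by rewrite /C; field; rewrite gt_eqF.
  have a1 : 0 <= n%:R * x by rewrite mulr_ge0 // ltW.
  have a2 : 0 <= (15 * x)^-1 by rewrite invr_ge0 mulr_ge0 // ltW.
  lra.
have u01 : 0 <= u < 1 by rewrite ltW.
have [n0 hn0] := geometric_small (C ^+ 2) u01 e0.
exists n0; apply: le_lt_trans (hn0 n0 (leqnn _)).
have -> : ((n0%:R + 15) / 15) ^+ 2 * s ^+ n0 = ((n0%:R + 15) / 15 * v ^+ n0) ^+ 2 * u ^+ n0.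
  have -> : s ^+ n0 = u ^+ n0 * u ^+ n0 by rewrite -uu exprAC expr2.
  have {1}-> : u ^+ n0 = (v ^+ n0) ^+ 2 by rewrite -vv exprAC.
  by ring.
rewrite ler_pM2r ?exprn_gt0 // ler_pXn2r ?nnegrE ?(ltW C0) //.
by rewrite mulr_ge0 ?exprn_ge0 ?divr_ge0 ?addr_ge0 // ltW.
Qed.

Lemma multiplier_real t : multiplier t%:C = (1 - t / 20)%:C :> R[i].
Proof. by rewrite /multiplier rmorphB rmorph1 rmorphM fmorphV rmorph_nat. Qed.

(** The 4^d squares around the pieces of generation d have total perimeter of
    order d^2 (1 - t / 20)^d, which tends to 0. *)
Lemma deriv_infty_moved_cantor t (f : sphere R -> cplx R) : 0 < t < 1 ->
  analytic_on (sphere_setC (moved_cantor 0 t%:C)) f ->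
  (forall z, ~ moved_cantor 0 t%:C z -> N (f (Some z)) <= 1) -> deriv_infty f = 0.
Proof.
move=> t01 fa f1.
have l1 : N (t%:C : R[i]) <= 1 by rewrite normc_real ger0_norm; lra.
have S1 n w : moved_cantor n t%:C w -> N w < 1 by exact: moved_cantor_norm.
have S1' n w : moved_cantor n t%:C w -> `|Re w| < 1 /\ `|Im w| < 1.
  by move=> /S1 h; split; [exact: le_lt_trans (Re_le_normc _) h|exact: le_lt_trans (Im_le_normc _) h].
pose s := 1 - t / 20.
have s01 : 0 < s < 1 by rewrite /s; lra.
have /andP[s0 s1] := s01.
pose q n := ratio n * s.
have q5 n : 0 < q n < 2 / 5.
  rewrite mulr_gt0 ?ratio_gt0 //=; apply: le_lt_trans (_ : _ <= 2 / 7 * 1) _; last lra.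
  by apply: ler_pM; rewrite ?ratio_le ?(ltW s0) ?(ltW s1) // ltW // ratio_gt0.
have piece n w : moved_cantor n t%:C w -> exists b, exists2 w', moved_cantor n.+1 t%:C w' &
    w = centre b + (q n)%:C * w'.
  move=> /(moved_cantor_piece l1)[b [w' hw' ->]]; exists b; exists w' => //.
  by rewrite multiplier_real -rmorphM.
have tree := square_integral_tree q5 S1' piece.
apply: Normc.eq0_normc; apply/eqP; rewrite eq_le normc_ge0 andbT.
apply/ler_addgt0Pr => e e0; rewrite add0r.
have e4 : 0 < e / 4 by lra.
have [n hn] := poly_geometric_small s01 e4.
have := tree _ n 0%N 0 1 ltr01 (holo_off_of_analytic fa f1); rewrite add0n.
have -> : \prod_(0 <= k < n) (4 * q k) = ((n%:R + 15) / 15) ^+ 2 * s ^+ n.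
  rewrite -ratio_prod -[n in s ^+ n]subn0 -(prodr_const_nat 0 n s) -big_split /=.
  by apply: eq_bigr => k _; rewrite /q mulrA.
have := deriv_infty_le_integral (S1 0%N) fa; lra.
Qed.

Lemma sup_all0 (A : set R) : (forall x, A x -> x = 0) -> sup A = 0.
Proof.
move=> h; have [[x Ax]|nA] := pselect (exists x, A x).
  have -> : A = [set 0].
    by apply/seteqP; split=> [y /h //|_ ->]; rewrite -(h x Ax).
  by rewrite sup1.
suff -> : A = set0 by rewrite sup0.
by apply/seteqP; split=> // y Ay; case: nA; exists y.
Qed.

Lemma capacity_moved_cantor t : 0 < t < 1 ->
  analytic_capacity (moved_cantor 0 t%:C : set (cplx R)) = 0 /\
  continuous_analytic_capacity (moved_cantor 0 t%:C : set (cplx R)) = 0.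
Proof.
move=> t01; split; apply: sup_all0 => x [f [[_ fa] f1] <-];
  rewrite (deriv_infty_moved_cantor t01 fa) ?Normc.normc0 // => z hz; rewrite -normr_le1.
  by apply: f1; apply/sphere_setC_some.
exact: f1.
Qed.

Section ScaledPotential.
Variable k : R.
Hypotheses (k0 : 0 < k) (k6 : k <= 1 / 6) (kP : forall z, k * N (cantor_potential z) <= 1).

Let k1 : k <= 1.
Proof. by apply: le_trans k6 _; lra. Qed.

(** The factor k normalizes the transform so that it is bounded by 1. *)
Definition cantor_function (p : sphere R) : cplx R :=
  if p is Some z then k%:C * cantor_potential z else 0.

Lemma cantor_function_le1 p : N (cantor_function p) <= 1.
Proof.
rewrite /cantor_function; case: p => [z|]; last by rewrite Normc.normc0.
by rewrite Normc.normcM normc_real gtr0_norm.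
Qed.

Lemma cantor_function_infty z : 7 / 5 <= N z ->
  N (cantor_function (Some z) - k%:C * z^-1) <= 1 / N z ^+ 2.
Proof.
move=> h; rewrite /= -mulrBr Normc.normcM normc_real gtr0_norm //.
have := cantor_potential_infty h.
have : 0 <= (N z ^+ 2)^-1 by rewrite invr_ge0 sqr_ge0.
set X := (N z ^+ 2)^-1; set Y := N _ => X0 YX.
have Y0 : 0 <= Y by exact: normc_ge0.
have h2 : k * Y <= 1 / 6 * Y by rewrite ler_wpM2r.
lra.
Qed.

Lemma cantor_function_analytic : analytic_on (sphere_setC (cantor 0 : set (cplx R))) cantor_function.
Proof.
move=> [z /sphere_setC_some /cantor_potential_cdiff[l hl]|_]; apply/derivable_cdiffP.
  exists (k%:C * l) => e e0; have [d d0 hd] := hl e e0; exists d => // h /hd hh.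
  have -> : cantor_function (Some (z + h)) - cantor_function (Some z) - h * (k%:C * l) =
     k%:C * (cantor_potential (z + h) - cantor_potential z - h * l).
    by rewrite /=; ring.
  rewrite Normc.normcM normc_real gtr0_norm //.
  by apply: le_trans hh; rewrite ler_piMl ?normc_ge0.
exists k%:C => e e0.
exists (Num.min (5 / 7) e); first by rewrite lt_min e0 andbT; lra.
move=> h; rewrite lt_min => /andP[h1 h2]; rewrite add0r sphere_inv0 subr0.
have [->|h0] := eqVneq h 0.
  by rewrite sphere_inv0 mul0r subr0 Normc.normc0 mulr0.
have nh : 0 < N h by rewrite normc_gt0.
rewrite -[h in sphere_inv (Some h)]invrK sphere_invV ?invr_eq0 //.
have := @cantor_function_infty h^-1; rewrite Normc.normcV.
have hn : 7 / 5 <= (N h)^-1 by rewrite -[7 / 5]invrK lef_pV2 ?posrE ?invr_gt0 //; lra.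
move=> /(_ hn); rewrite invrK [_%:C * h]mulrC => /le_trans; apply.
by rewrite exprVn invrK mul1r expr2 ler_wpM2r // ltW.
Qed.

Lemma cantor_function_continuous : continuous cantor_function.
Proof.
move=> [z|].
  move=> A hA; suff : {for z, continuous (fun z : cplx R => cantor_function (Some z))} by apply.
  apply/continuous_cplxP => e e0.
  have [d d0 hd] := @cantor_potential_continuous R z e e0; exists d => // w /hd h.
  rewrite /= -mulrBr Normc.normcM normc_real gtr0_norm //.
  by apply: le_lt_trans h; rewrite ler_piMl ?normc_ge0.
move=> A /nbhs_cplxP[e e0 hA].
apply: (@nbhs_infty _ (Num.max (7 / 5) (2 / e))).
  by apply: hA; rewrite subrr Normc.normc0.
move=> z; rewrite gt_max => /andP[h1 h2]; apply: hA; rewrite subr0.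
have nz : 0 < N z by lra.
have := cantor_function_infty (ltW h1) => h3.
have := normcD (cantor_function (Some z) - k%:C * z^-1) (k%:C * z^-1).
have -> : N (k%:C * z^-1) = k * (N z)^-1.
  by rewrite Normc.normcM Normc.normcV normc_real gtr0_norm.
rewrite subrK.
rewrite ltr_pdivrMr // in h2.
have i0 : 0 < (N z)^-1 by rewrite invr_gt0.
have i1 : (N z)^-1 < e / 2.
  by rewrite -[e / 2]invrK ltf_pV2 ?posrE ?invr_gt0 // ?divr_gt0 // invf_div ltr_pdivrMr.
have i2 : 1 / N z ^+ 2 <= (N z)^-1.
  by rewrite mul1r lef_pV2 ?posrE ?exprn_gt0 // expr2 ler_peMl ?(ltW nz) //; lra.
have i3 : k * (N z)^-1 <= (N z)^-1 by rewrite ler_piMl ?k1 // ltW.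
lra.
Qed.

Lemma deriv_infty_cantor_function : deriv_infty cantor_function = k%:C.
Proof.
apply: deriv_inftyE => e e0; exists (Num.max (7 / 5) e^-1) => z.
rewrite gt_max => /andP[h1 h2]; rewrite subr0.
apply: le_trans (cantor_function_infty (ltW h1)) _.
have nz : 0 < N z by lra.
rewrite expr2 invfM mulrA ler_pM2r ?invr_gt0 // mul1r.
by rewrite -[e]invrK lef_pV2 ?posrE ?invr_gt0 // ltW.
Qed.

End ScaledPotential.

Lemma scaled_potential : exists k : R,
  [/\ 0 < k, k <= 1 / 6 & forall z, k * N (cantor_potential z) <= 1].
Proof.
have [M [M6 hM]] : exists M : R, 6 <= M /\ forall z, N (cantor_potential z) <= M.
  by exists 371; split; [lra|exact: cantor_potential_le].
have M0 : 0 < M by lra.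
exists M^-1; split=> [||z]; first by rewrite invr_gt0.
  by rewrite -div1r ler_pdivrMr //; lra.
by rewrite mulrC ler_pdivrMr // mul1r.
Qed.

Lemma capacity_cantor :
  0 < analytic_capacity (cantor 0 : set (cplx R)) /\
  0 < continuous_analytic_capacity (cantor 0 : set (cplx R)).
Proof.
have S1 (w : R[i]) : cantor 0 w -> N w < 1 by move=> /cantor_norm; lra.
have [k [k0 k6 kP]] := scaled_potential.
have nk : N (deriv_infty (cantor_function k)) = k.
  by rewrite deriv_infty_cantor_function // normc_real gtr0_norm.
have fc := cantor_function_continuous k0 k6; have fa := cantor_function_analytic k0 k6.
have f1 := cantor_function_le1 k0 kP.
split; apply: lt_le_trans k0 _; rewrite -[leLHS]nk; apply: ub_le_sup.
- exists 4 => x [f [[_ ha] h1] <-]; apply: (deriv_infty_le4 S1 ha) => z hz.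
  by rewrite -normr_le1; apply: h1; apply/sphere_setC_some.
- exists (cantor_function k) => //; split; last by move=> q _; rewrite normr_le1.
  split=> //; exists 1; split; first exact: real1.
  by move=> M M1 q _ /=; apply: le_trans (ltW M1); rewrite normr_le1.
- exists 4 => x [f [[_ ha] h1] <-]; apply: (deriv_infty_le4 S1 ha) => z hz.
  by rewrite -normr_le1; exact: h1.
- exists (cantor_function k) => //; split; last by move=> z; rewrite normr_le1.
  by split.
Qed.

Definition cantor_motion (l : cplx R) (p : sphere R) : sphere R :=
  if p is Some z then Some (motion 0 l z) else None.

Lemma mem_unit_disk l : (l : cplx R) \in @unit_disk R -> N l < 1.
Proof. by rewrite inE /unit_disk /= normr_lt1. Qed.

Lemma cantor_motion_holomorphic : holomorphic_motion cantor_motion.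
Proof.
split=> [p l /mem_unit_disk l1|l /mem_unit_disk l1|p].
- case: p => [z|]; last first.
    split; first by move=> A /nbhs_singleton hA; exact: filterS (fun _ _ => hA) filterT.
    by apply/derivable_cdiffP; exists 0 => e e0; exists 1 => // h _ /=;
      rewrite subrr mulr0 subr0 Normc.normc0 mulr_ge0 ?normc_ge0 // ltW.
  have [L hL] := motion_cdiff 0 z l1; split; last by apply/derivable_cdiffP; exists L.
  have mc : {for l, continuous (fun l : cplx R => motion 0 l z : cplx R)}.
    by apply/continuous_cplxP; exact: cdiff_continuous hL.
  by move=> A hA; exact: (mc (Some @^-1` A) hA).
- move=> [z|] [w|] //= [/(motion_inj (ltW l1)) -> //].
- by case: p => [z|] //=; rewrite motion0.
Qed.

Lemma motion_image_cantor l : motion_image cantor_motion (cantor 0) l = moved_cantor 0 l.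
Proof.
apply/seteqP; split=> [z [_ [x cx <-] [<-]]|_ [x cx <-]]; first by exists x.
by exists (Some x) => //; exists x.
Qed.

(** Continuity at 0 would bring the value at a small positive real parameter,
    which is 0, within cap (cantor 0) of cap (cantor 0). *)
Lemma discontinuous_at0 (cap : set (cplx R) -> R) : 0 < cap (cantor 0) ->
  (forall t : R, 0 < t < 1 -> cap (moved_cantor 0 t%:C) = 0) ->
  ~ {for (0 : cplx R), continuous (fun l : cplx R => cap (motion_image cantor_motion (cantor 0) l))}.
Proof.
move=> c0 ct /continuous_cplx_realP /(_ _ c0)[d d0 hd].
pose t : R := Num.min (d / 2) (1 / 2).
have t0 : 0 < t by rewrite lt_min; apply/andP; split; lra.
have t1 : t <= 1 / 2 by rewrite ge_min lexx orbT.
have td : t <= d / 2 by rewrite ge_min lexx.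
have := hd t%:C; rewrite subr0 normc_real ger0_norm ?(ltW t0) // => /(_ ltac:(lra)).
rewrite !motion_image_cantor moved_cantor0 ct; last by apply/andP; split; lra.
by rewrite sub0r normrN ltNge ler_norm.
Qed.

End Capacity.

Theorem corollary1p4 (R : realType) :
  exists (K : set (cplx R)) (g : cplx R -> sphere R -> sphere R),
    [/\ compact K,
        holomorphic_motion g,
        {in @unit_disk R, forall l, g l None = None},
        ~ {for (0 : cplx R), continuous
             (fun l : cplx R => analytic_capacity (motion_image g K l))}
      & ~ {for (0 : cplx R), continuous
             (fun l : cplx R =>
                continuous_analytic_capacity (motion_image g K l))}].
Proof.
have [c1 c2] := @capacity_cantor R.
exists (cantor 0), (@cantor_motion R); split=> //.
- exact: cantor_compact.
- exact: cantor_motion_holomorphic.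
- by apply: discontinuous_at0 => // t /capacity_moved_cantor[].
- by apply: discontinuous_at0 => // t /capacity_moved_cantor[].
Qed.
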